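(* For every $k\in\mathbb Z_{\ge0}$, $$\Delta_{n,q}(f_k)=\frac{q^2}{(1-q^2)^2}\left((1-q^{2k+2})f_{k+1}-(1+q^{-2n}-2q^{2k})f_k+(q^{-2n}-q^{2k-2})f_{k-1}\right),$$ where $f_k\equiv0$ for $k<0$.
   Context: **Notation.** Fix an integer $n\ge1$, $q\in(0,1)$ and a real number $\alpha>0$. $(a;q)_m=\prod_{j=0}^{m-1}(1-aq^j)$. For $\underline i,\underline j\in\mathbb Z_{\ge0}^n$: $|\underline i|=i_1+\dots+i_n$, $\underline i\times\underline j=(i_1j_1,\dots,i_nj_n)$; $P(n)=\{\underline k\in\mathbb Z^n_{\ge0}: k_1\ge\dots\ge k_n\}$; $\mathbf z^{\underline i}=z_n^{i_n}\cdots z_1^{i_1}$, $\mathbf z^{*\underline i}=z_1^{*i_1}\cdots z_n^{*i_n}$. **Polynomials.** $\mathcal P(\mathbb C^n)_q$ is the unital $*$-algebra with generators $z_1,\dots,z_n$ and relations $z_iz_j=qz_jz_i$ ($i<j$), $z_i^*z_j=qz_jz_i^*$ ($i\ne j$), $z_j^*z_j=q^2z_jz_j^*+(1-q^2)(1-\sum_{k>j}z_kz_k^* )$. $\mathbb C[\mathbb C^n]_q$ is the subalgebra generated by $z_1,\dots,z_n$; the monomials $\mathbf z^{\underline m}$ form a basis of it. Put $y_i=1-z_iz_i^*-\dots-z_nz_n^*$ and $y=y_1$. **Finite functions and distributions.** Let $H$ be the $\mathcal P(\mathbb C^n)_q$-module generated by a vector $e_0$ with $z_i^*e_0=0$ for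 all $i$; it has basis $\mathbf z^{\underline m}e_0$, carries a scalar product (unique up to scale) with $(fu,v)=(u,f^*v)$, and is a faithful representation; $y_j\mathbf z^{\underline m}e_0=q^{2(m_j+\dots+m_n)}\mathbf z^{\underline m}e_0$. Identify $\mathcal P(\mathbb C^n)_q$ with its image in $\mathrm{End}(H)$. $\mathcal D(U_n)_q$ (finite functions) is the $*$-algebra of linear operators on $H$ having finitely many nonzero matrix entries in this basis. For a function $g$ on $\mathfrak M=\{(q^{2k_1},\dots,q^{2k_n}):\underline k\in P(n)\}$, $g(y_1,\dots,y_n)$ is the diagonal operator $\mathbf z^{\underline m}e_0\mapsto g(q^{2k_1},\dots,q^{2k_n})\mathbf z^{\underline m}e_0$, $k_j=m_j+\dots+m_n$. Each $f\in\mathcal D(U_n)_q$ (resp. $f\in\mathcal P(\mathbb C^n)_q$) is uniquely a finite sum $f=\sum_{\underline i\times\underline j=\underline 0}\mathbf z^{\underline i}f_{\underline i,\underline j}(y_1,\dots,y_n)\mathbf z^{*\underline j}$ with $f_{\underline i,\underline j}$ finitely supported functions on $\mathfrak M$ (resp. polynomials). $\mathcal D(U_n)'_q$ (distributions) is the space of infinite formal sums of this form with arbitrary functions $f_{\underline i,\underline j}$ on $\mathfrak M$, with the topology of pointwise convergence of coefficients (equivalently, all infinite matrices in the basis $\mathbf z^{\underline m}e_0$); it is the completion of $\mathcal D(U_n)_q$ and a right $\mathcal D(U_n)_q$-module. The invariant integral on $\mathcal D(U_n)_q$ is $\int_{U_n}f\,d\nu_q=(q^2;q^2)_n\sum_{\underline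 k\in P(n)}f_{\underline 0,\underline 0}(q^{2k_1},\dots,q^{2k_n})q^{-2nk_1}q^{2k_2}\cdots q^{2k_n}$; it gives (by continuity) a nondegenerate pairing $(\psi,\varphi)\mapsto\int_{U_n}\psi\varphi\,d\nu_q$ of $\mathcal D(U_n)'_q$ with $\mathcal D(U_n)_q$. **Toeplitz operators.** $\int_{U_n}f\,dm_{\alpha,q}=(q^{2\alpha+2};q^2)_n\sum_{\underline k\in P(n)}f_{\underline 0,\underline 0}(q^{2k_1},\dots,q^{2k_n})q^{2k_1(\alpha+1)}q^{2k_2}\cdots q^{2k_n}$; $(f,g)_{\alpha,q}=\int_{U_n}g^*f\,dm_{\alpha,q}$; $L^2(dm_{\alpha,q})$ is the completion of $\mathcal D(U_n)_q$ for this scalar product; it contains $\mathcal P(\mathbb C^n)_q$. $P_{\alpha,q}$ is the orthogonal projection onto the closure of $\mathbb C[\mathbb C^n]_q$. $\mathbb C[\mathbb C^n]_{q,\alpha}$ denotes $\mathbb C[\mathbb C^n]_q$ with this scalar product. For $f\in\mathcal D(U_n)_q$, $T_f\in\mathrm{End}(\mathbb C[\mathbb C^n]_{q,\alpha})$ is $T_f\psi=P_{\alpha,q}(f\psi)$; its matrix in the basis $\mathbf z^{\underline m}$ has finitely many nonzero entries. **Covariant symbols and Berezin transform.** For an operator with finitely many nonzero matrix entries, $A\mathbf z^{\underline m}=\sum_{\underline k}A^{\underline m}_{\underline k}\mathbf z^{\underline k}$, set $\mathrm{Tr}_q(A)=\frac{(q^2;q^2)_n}{(q^{2+2\alpha};q^2)_n}\sum_{\underline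 m}A^{\underline m}_{\underline m}q^{-2n|\underline m|}q^{2(m_2+\dots+m_n)}q^{2(m_3+\dots+m_n)}\cdots q^{2m_n}$. The covariant symbol of $T\in\mathrm{End}(\mathbb C[\mathbb C^n]_{q,\alpha})$ is the unique $\sigma(T)\in\mathcal D(U_n)'_q$ with $\int_{U_n}\sigma(T)f\,d\nu_q=\mathrm{Tr}_q(T\,T_f)$ for all $f\in\mathcal D(U_n)_q$. The $q$-Berezin transform is $B_{q,\alpha}:\mathcal D(U_n)_q\to\mathcal D(U_n)'_q$, $f\mapsto\sigma(T_f)$. **Laplace–Beltrami operator.** With $t=q^{2\alpha}$ write $B_{q,t}=B_{q,\alpha}$; for fixed $f,g\in\mathcal D(U_n)_q$, $\int_{U_n}B_{q,t}(f)g\,d\nu_q$ is a polynomial in $t$. $\Delta_{n,q}=\frac{q^{-2n}}{1-q^2}\frac{dB_{q,t}}{dt}\big|_{t=0}$ (derivative taken in these matrix entries); it maps $\mathcal D(U_n)_q$ to itself. **Radial finite functions.** For $k\in\mathbb Z_{\ge0}$, $f_k=f_k(y)\in\mathcal D(U_n)_q$ is the function of $y=y_1$ only with $f_k(q^{2k})=1$ and $f_k(q^{2l})=0$ for $l\ne k$. *)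

(* Defs.v *)
From HB Require Import structures.
From mathcomp Require Import all_boot all_order all_algebra.
From mathcomp Require Import finmap complex ring lra zify.
From mathcomp Require Import all_classical all_reals all_analysis.
Set Implicit Arguments.
Unset Strict Implicit.
Unset Printing Implicit Defensive.
Import Order.TTheory GRing.Theory Num.Theory.
Import numFieldNormedType.Exports.
Local Open Scope classical_set_scope.
Local Open Scope ring_scope.
Local Open Scope complex_scope.

(* The dimension is n.+1, so that it is at least 1; the usual index j of
   1, ..., dimension is the ordinal of value j - 1. *)
Notation mi n := {ffun 'I_n.+1 -> nat}.

(* A linear operator on H is identified with its matrix in the basis
   (z^m e_0)_m: A a b is the coefficient of z^a e_0 in A (z^b e_0).
   Arbitrary infinite matrices are the distributions. The codomain is R[i]
   with its structures of module and of topological space. *)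
Notation qop R n := (mi n -> mi n -> R[i]^o).

Definition qpoch (R : realType) (a p : R) (m : nat) : R :=
  \prod_(j < m) (1 - a * p ^+ j).

Section Ball.
Variables (R : realType) (n : nat) (q : R).

Local Notation C := R[i]^o.
Local Notation mi := (mi n).
Local Notation qop := (qop R n).

(* (m_j + ... + m_n)_j *)
Definition tails (m : mi) : mi :=
  [ffun j : 'I_n.+1 => (\sum_(l < n.+1 | j <= l) m l)%N].

Definition up (i : 'I_n.+1) (m : mi) : mi := [ffun j => m j + (j == i)]%N.
Definition down (i : 'I_n.+1) (m : mi) : mi := [ffun j => m j - (j == i)]%N.

(* z^m e_0 |-> c m * z^(s m) e_0 *)
Definition wshift (s : mi -> mi) (c : mi -> R) : qop :=
  fun a b => (a == s b)%:R * (c b)%:C.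

(* Products are only used for pairs of matrices such that, in each entry,
   finitely many terms are nonzero. *)
Definition qmul (A B : qop) : qop :=
  fun a b => \sum_(c \in [set: mi]) A a c * B c b.
Definition qone : qop := fun a b => (a == b)%:R.

(* The action of the generators obtained by moving z_i, resp. z_i^*, through
   z^m = z_n^{m_n} ... z_1^{m_1} with the defining relations, and z_i^* e_0 = 0;
   see zz_rel, zsz_rel, zsz_diag_rel, zs_vacuum and zmon_vacuum below (the
   relations between the z_i^* are the adjoints of zz_rel). When m_i = 0
   the truncated subtraction in down is multiplied by zero. *)
Definition z (i : 'I_n.+1) : qop :=
  wshift (up i) (fun m => q ^+ (\sum_(l < n.+1 | (i < l)%N) m l)).
Definition zs (i : 'I_n.+1) : qop :=
  wshift (down i)
    (fun m => q ^+ (\sum_(l < n.+1 | (i < l)%N) m l) * (1 - q ^+ (2 * m i))).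

(* z_n^{m_n} ... z_1^{m_1}; the big product is ordered *)
Definition zmon (m : mi) : qop :=
  \big[qmul/qone]_(j < n.+1) iter (m (rev_ord j)) (qmul (z (rev_ord j))) qone.
(* z_1^{*m_1} ... z_n^{*m_n} *)
Definition zsmon (m : mi) : qop :=
  \big[qmul/qone]_(j < n.+1) iter (m j) (qmul (zs j)) qone.

(* The squared norm of z^m e_0, for the scalar product on H for which e_0 has
   norm 1 and zs i is the adjoint of z i; this basis is orthogonal. star is the
   adjunction for this scalar product; see star_adjoint and star_z below. *)
Definition hnorm2 (m : mi) : R := \prod_j qpoch (q ^+ 2) (q ^+ 2) (m j).

Definition star (A : qop) : qop :=
  fun a b => conjc (A b a) * (hnorm2 b / hnorm2 a)%:C.

Definition finite_op : set qop :=
  [set A | finite_set [set ab : mi * mi | A ab.1 ab.2 != 0]].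

Definition Pn : set mi :=
  [set k | forall i j : 'I_n.+1, (i <= j)%N -> (k j <= k i)%N].

(* The points of the set M are the [point k] with k in Pn; functions on M are
   represented by functions on R^n, whose values outside M are never used. *)
Definition point (k : mi) : 'I_n.+1 -> R := fun j => q ^+ (2 * k j).

(* g(y_1, ..., y_n) *)
Definition fun_y (g : ('I_n.+1 -> R) -> C) : qop :=
  fun a b => (a == b)%:R * g (point (tails b)).

(* f is the sum of the z^i c_{i,j}(y_1, ..., y_n) z^{*j} over i x j = 0, as a
   formal sum: each matrix entry involves at most one nonzero term. For a finite
   function the sum is finite and the c_{i,j} are finitely supported on M. The
   values of the c_{i,j} on M are unique. *)
Definition qdecomp (f : qop) (c : mi -> mi -> ('I_n.+1 -> R) -> C) : Prop :=
  forall a b, f a b =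
    \sum_(ij \in [set ij : mi * mi | forall l, (ij.1 l * ij.2 l = 0)%N])
      qmul (zmon ij.1) (qmul (fun_y (c ij.1 ij.2)) (zsmon ij.2)) a b.

Definition qcoef (f : qop) : mi -> mi -> ('I_n.+1 -> R) -> C :=
  xget 0 [set c | qdecomp f c].

Definition coef00 (f : qop) : ('I_n.+1 -> R) -> C :=
  qcoef f [ffun=> 0%N] [ffun=> 0%N].

(* The sum makes sense for every distribution f such that coef00 f is finitely
   supported on M, as is the case for S f with S a distribution and f a finite
   function; this is how the pairing extends by continuity. *)
Definition int_nu (f : qop) : C :=
  (qpoch (q ^+ 2) (q ^+ 2) n.+1)%:C *
  \sum_(k \in Pn) coef00 f (point k) *
    (q ^- (2 * n.+1 * k ord0) * \prod_(j < n) q ^+ (2 * k (lift ord0 j)))%:C.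

Definition int_m (alpha : R) (f : qop) : C :=
  (qpoch (q `^ (2 * alpha + 2)) (q ^+ 2) n.+1)%:C *
  \sum_(k \in Pn) coef00 f (point k) *
    (q `^ (2 * (k ord0)%:R * (alpha + 1)) *
     \prod_(j < n) q ^+ (2 * k (lift ord0 j)))%:C.

Definition dot (alpha : R) (f g : qop) : C := int_m alpha (qmul (star g) f).

(* The completion of finite_op for [dot alpha] is realized as a space of
   distributions: a Cauchy sequence of finite functions converges
   coefficientwise, and its class is determined by the limit. *)
Definition approx (alpha : R) (u : nat -> qop) (F : qop) : Prop :=
  [/\ forall k, finite_op (u k),
      forall e : R[i], 0 < e -> exists K, forall k l, (K <= k)%N -> (K <= l)%N ->
        dot alpha (u k - u l) (u k - u l) < e
    & forall a b, (fun k => u k a b) @ \oo --> F a b].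

Definition L2 (alpha : R) : set qop := [set F | exists u, approx alpha u F].

Definition dotL2 (alpha : R) (F G : qop) : C :=
  xget 0 [set l : C | exists u v, [/\ approx alpha u F, approx alpha v G
    & (fun k => dot alpha (u k) (v k)) @ \oo --> l]].

Definition is_hol_coord (p : qop) (c : mi -> C) : Prop :=
  finite_set [set m | c m != 0] /\
  p = \sum_(m \in [set: mi]) (c m *: zmon m : qop).

(* C[C^n]_q *)
Definition hol : set qop := [set p | exists c, is_hol_coord p c].

Definition hol_coord (p : qop) : mi -> C := xget 0 [set c | is_hol_coord p c].

Definition hol_closure (alpha : R) : set qop :=
  [set G | L2 alpha G /\ forall e : R[i], 0 < e ->
    exists2 p, hol p & dotL2 alpha (G - p) (G - p) < e].

Definition proj (alpha : R) (F : qop) : qop :=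
  xget 0 [set G | hol_closure alpha G /\
    forall G', hol_closure alpha G' -> dotL2 alpha (F - G) G' = 0].

Definition toeplitz (alpha : R) (f : qop) : qop -> qop :=
  fun psi => proj alpha (qmul f psi).

(* The trace of an endomorphism T of C[C^n]_q; T is only applied to hol. *)
Definition qtrace (alpha : R) (T : qop -> qop) : C :=
  (qpoch (q ^+ 2) (q ^+ 2) n.+1 /
   qpoch (q `^ (2 + 2 * alpha)) (q ^+ 2) n.+1)%:C *
  \sum_(m \in [set: mi]) hol_coord (T (zmon m)) m *
    (q ^- (2 * n.+1 * \sum_j m j) *
     \prod_(j < n) q ^+ (2 * tails m (lift ord0 j)))%:C.

Definition symbol (alpha : R) (T : qop -> qop) : qop :=
  xget 0 [set S | forall f, finite_op f ->
    int_nu (qmul S f) = qtrace alpha (T \o toeplitz alpha f)].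

Definition berezin (alpha : R) (f : qop) : qop :=
  symbol alpha (toeplitz alpha f).

(* p is the polynomial in t = q^(2 alpha) equal to the matrix entry of
   B_{q,t} f against g; its values on 0 < alpha determine it. *)
Definition laplace (f : qop) : qop :=
  xget 0 [set L | forall g, finite_op g ->
    exists2 p : {poly R[i]},
      (forall alpha : R, 0 < alpha ->
        p.[(q `^ (2 * alpha))%:C] = int_nu (qmul (berezin alpha f) g))
    & int_nu (qmul L g) = (q ^- (2 * n.+1) / (1 - q ^+ 2))%:C * p^`().[0]].

Definition radial (k : int) : qop :=
  if k is Posz k' then fun_y (fun y => (y ord0 == q ^+ (2 * k'))%:R) else 0.

Lemma fsum1 (b : mi) (F : mi -> C) :
  (forall c, c != b -> F c = 0) -> \sum_(c \in [set: mi]) F c = F b.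
Proof.
move=> F0; rewrite (fsbigTE [fset b]%fset) ?big_seq_fset1//.
by move=> c; rewrite inE => /F0.
Qed.

Lemma qmul_wshift (A : qop) s c a b :
  qmul A (wshift s c) a b = A a (s b) * (c b)%:C.
Proof.
rewrite /qmul (fsum1 (b := s b)) /wshift ?eqxx ?mul1r// => d /negPf ->.
by rewrite mul0r mulr0.
Qed.

Lemma wshiftM s c s' c' : qmul (wshift s c) (wshift s' c') =
  wshift (s \o s') (fun m => c (s' m) * c' m).
Proof.
apply/funext => a; apply/funext => b.
by rewrite qmul_wshift /wshift /= rmorphM mulrA.
Qed.

Lemma qone_wshift : qone = wshift id (fun=> 1).
Proof. by apply/funext=> a; apply/funext=> b; rewrite /wshift mulr1. Qed.

Lemma sum_up i (P : pred 'I_n.+1) (m : mi) :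
  (\sum_(l | P l) up i m l = \sum_(l | P l) m l + P i)%N.
Proof.
under eq_bigr do rewrite ffunE.
rewrite big_split/=; congr addn.
case Pi: (P i); last by rewrite big1// => l Pl; case: eqP Pl => // ->; rewrite Pi.
rewrite (bigD1 i)//= eqxx big1// => l /andP[_ /negPf ->].
by [].
Qed.

Lemma sum_down i (P : pred 'I_n.+1) (m : mi) : (0 < m i)%N ->
  (\sum_(l | P l) down i m l + P i = \sum_(l | P l) m l)%N.
Proof.
move=> mi0; have {2}-> : m = up i (down i m); last by rewrite sum_up.
apply/ffunP => l; rewrite !ffunE; case: eqP => [->|_]; by rewrite ?subnK ?subn0 ?addn0.
Qed.

Lemma upC i j (m : mi) : up i (up j m) = up j (up i m).
Proof. by apply/ffunP => l; rewrite !ffunE addnAC. Qed.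

Lemma down_up i j (m : mi) : i != j -> down i (up j m) = up j (down i m).
Proof.
move=> ij; apply/ffunP => l; rewrite !ffunE.
by case: (eqVneq l i) => [->|_]; rewrite ?(negPf ij)//; lia.
Qed.

Lemma upK i (m : mi) : down i (up i m) = m.
Proof. by apply/ffunP => l; rewrite !ffunE addnK. Qed.

Lemma downK i (m : mi) : (0 < m i)%N -> up i (down i m) = m.
Proof. move=> mi0; apply/ffunP => l; rewrite !ffunE.
by case: eqP => [->|_]; rewrite ?subnK ?subn0 ?addn0. Qed.

Lemma zz_rel (i j : 'I_n.+1) : (i < j)%N ->
  qmul (z i) (z j) = q%:C *: (qmul (z j) (z i) : qop).
Proof.
move=> ij; rewrite !wshiftM; apply/funext => a; apply/funext => b.
rewrite /wshift /= !fctE /GRing.scale/= upC mulrCA -rmorphM/=.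
congr (_ * _%:C); rewrite !sum_up ij ltnNge (ltnW ij) addn0 addn1 exprS; ring.
Qed.

Lemma zsz_rel (i j : 'I_n.+1) : i != j ->
  qmul (zs i) (z j) = q%:C *: (qmul (z j) (zs i) : qop).
Proof.
move=> ij; rewrite !wshiftM; apply/funext => a; apply/funext => b.
rewrite /wshift /= !fctE /GRing.scale/= (down_up _ ij) mulrCA -rmorphM/=.
congr (_ * _%:C); rewrite sum_up ffunE (negPf ij) addn0.
have [bi0|bi0] := posnP (b i).
  by rewrite bi0 muln0 expr0 subrr !(mulr0, mul0r).
rewrite -(sum_down (fun l : 'I_n.+1 => (j < l)%N) bi0).
have [ji|ij'] := ltnP j i; last first.
  have {}ij' : (i < j)%N by rewrite ltn_neqAle ij ij'.
  by rewrite ij' addn0 addn1 exprS; ring.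
by rewrite ltnNge (ltnW ji) addn0 addn1 exprS; ring.
Qed.

Lemma tails_telescope (b : mi) (j : 'I_n.+1) :
  \sum_(k : 'I_n.+1 | (j < k)%N)
    q ^+ (2 * \sum_(l : 'I_n.+1 | (k < l)%N) b l) * (1 - q ^+ (2 * b k)) =
  1 - q ^+ (2 * \sum_(l : 'I_n.+1 | (j < l)%N) b l).
Proof.
pose s k := (\sum_(l : 'I_n.+1 | (k < l)%N) b l)%N.
pose T k := q ^+ (2 * s k).
have step (k : 'I_n.+1) : (0 < k)%N ->
    q ^+ (2 * s k) * (1 - q ^+ (2 * b k)) = T k - T k.-1.
  move=> k0; rewrite mulrBr mulr1 -exprD -mulnDr /T; congr (_ - _ ^+ (2 * _)).
  rewrite /s [in RHS](bigD1 k) ?prednK//= addnC; congr addn.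
  by apply: eq_bigl => l; rewrite -val_eqE/=; lia.
transitivity (\sum_(j.+1 <= k < n.+1) (T k - T k.-1)).
  rewrite big_geq_mkord; apply: eq_bigr => k jk.
  by rewrite step// (leq_ltn_trans _ jk).
rewrite big_add1/= telescope_sumr; last by rewrite -ltnS.
by rewrite /T {1}/s big1 ?muln0// => l; have := ltn_ord l; lia.
Qed.

Lemma wshiftZ (x : R) s c :
  x%:C *: (wshift s c : qop) = wshift s (fun m => x * c m).
Proof.
apply/funext => a; apply/funext => b.
rewrite /wshift rmorphM/=.
change (x%:C * ((a == s b)%:R * (c b)%:C) = (a == s b)%:R * (x%:C * (c b)%:C)).
by rewrite mulrCA.
Qed.

Lemma wshiftD s c c' :
  (wshift s c : qop) + (wshift s c' : qop) = wshift s (fun m => c m + c' m).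
Proof.
apply/funext => a; apply/funext => b.
rewrite [RHS]/wshift rmorphD/= mulrDr; reflexivity.
Qed.

Lemma wshiftN s c : - (wshift s c : qop) = wshift s (fun m => - c m).
Proof.
apply/funext => a; apply/funext => b.
rewrite [RHS]/wshift rmorphN/= mulrN; reflexivity.
Qed.

Lemma zzsE k : qmul (z k) (zs k) = wshift id (fun m =>
    q ^+ (2 * \sum_(l < n.+1 | (k < l)%N) m l) * (1 - q ^+ (2 * m k))).
Proof.
rewrite wshiftM; apply/funext => a; apply/funext => b; rewrite /wshift/=.
have [b0|b0] := posnP (b k); first by rewrite b0 muln0 expr0 subrr !mulr0.
rewrite downK//; congr (_ * _%:C).
rewrite -(sum_down (fun l : 'I_n.+1 => (k < l)%N) b0) ltnn addn0.
by rewrite mulrA -exprD addnn -mul2n.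
Qed.

Lemma sum_zzsE (j : 'I_n.+1) :
  \sum_(k < n.+1 | (j < k)%N) (qmul (z k) (zs k) : qop) =
  wshift id (fun m => 1 - q ^+ (2 * \sum_(l < n.+1 | (j < l)%N) m l)).
Proof.
under eq_bigr do rewrite zzsE.
apply/funext => a; apply/funext => b; rewrite /wshift -tails_telescope.
by rewrite fct_sumE fct_sumE rmorph_sum mulr_sumr.
Qed.

Lemma zsz_diag_rel (j : 'I_n.+1) :
  qmul (zs j) (z j) = (q ^+ 2)%:C *: (qmul (z j) (zs j) : qop) +
    (1 - q ^+ 2)%:C *:
      (qone - \sum_(k < n.+1 | (j < k)%N) (qmul (z k) (zs k) : qop)) :> qop.
Proof.
rewrite sum_zzsE zzsE wshiftM qone_wshift !(wshiftN, wshiftZ, wshiftD); apply/funext => a; apply/funext => b.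
rewrite /wshift/= upK; congr (_ * _%:C).
rewrite sum_up ltnn addn0 ffunE eqxx; set S := (\sum_(l | _) _)%N.
have -> : q ^+ (2 * S) = q ^+ S * q ^+ S by rewrite mul2n -addnn exprD.
rewrite (mulnDr 2%N (b j)) exprD muln1; ring.
Qed.

(* y_j = 1 - z_j z_j^* - ... - z_n z_n^* *)
Lemma fun_y_coord (j : 'I_n.+1) : fun_y (fun y => (y j)%:C) =
  qone - \sum_(k < n.+1 | (j <= k)%N) (qmul (z k) (zs k) : qop) :> qop.
Proof.
rewrite (bigD1 j)//=; under eq_bigl => k do rewrite andbC eq_sym -ltn_neqAle.
rewrite sum_zzsE zzsE wshiftD qone_wshift wshiftN wshiftD; apply/funext => a; apply/funext => b.
rewrite /wshift/fun_y/point/= ffunE; congr (_ * _%:C).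
rewrite (bigD1 j)//=; under eq_bigl => k do rewrite andbC eq_sym -ltn_neqAle.
rewrite mulnDr exprD; ring.
Qed.

Lemma zs_vacuum i a : zs i a [ffun=> 0%N] = 0.
Proof. by rewrite /zs/wshift ffunE muln0 expr0 subrr mulr0 mulr0. Qed.

Lemma qmul_col (A B : qop) b d :
  (forall c, B c d = (c == b)%:R) -> forall a, qmul A B a d = A a b.
Proof.
move=> Bd a; rewrite /qmul (fsum1 (b := b)) => [|c /negPf cb]; rewrite Bd ?eqxx ?mulr1//.
by rewrite cb mulr0.
Qed.

Lemma iter_z_col (j : 'I_n.+1) k (b : mi) : (forall l : 'I_n.+1, (j < l)%N -> b l = 0%N) ->
  forall a, iter k (qmul (z j)) qone a b =
    (a == [ffun l => b l + k * (l == j)]%N)%:R.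
Proof.
move=> b0; elim: k => [|k IH] a.
  by congr (_ == _)%:R; apply/ffunP => l; rewrite ffunE addn0.
rewrite iterS (qmul_col _ IH) /z/wshift big1 ?expr0 ?mulr1; last first.
  move=> l jl; rewrite ffunE b0//.
  by case: eqP jl => [->|]; rewrite ?ltnn// muln0.
by congr (_ == _)%:R; apply/ffunP => l; rewrite !ffunE; case: eqP => _; lia.
Qed.

(* z^m e_0 is the basis vector of index m *)
Lemma zmon_vacuum (m a : mi) : zmon m a [ffun=> 0%N] = (a == m)%:R.
Proof.
pose F j := iter (m j) (qmul (z j)) qone.
have claim (s : seq 'I_n.+1) : pairwise (fun i j : 'I_n.+1 => (j < i)%N) s ->
    forall a, (\big[qmul/qone]_(j <- s) F j) a [ffun=> 0%N] =
      (a == [ffun l => m l * (l \in s)]%N)%:R.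
  elim: s => [|j s IH]/=.
    move=> _ a'; rewrite big_nil; congr (_ == _)%:R.
    by apply/ffunP => l; rewrite !ffunE muln0.
  move=> /andP[/allP js /IH{}IH] a'; rewrite big_cons (qmul_col _ IH).
  rewrite {1}/F iter_z_col => [|l jl]; last first.
    rewrite ffunE; case: (boolP (l \in s)) => [/js|_]; last by rewrite muln0.
    by rewrite ltnNge (ltnW jl).
  congr (_ == _)%:R; apply/ffunP => l; rewrite !ffunE inE.
  case: eqP => [->|_]; last by rewrite muln0 addn0.
  rewrite muln1; case: (boolP (j \in s)) => [/js|_]; first by rewrite ltnn.
  by rewrite muln0.
rewrite /zmon -(big_map (@rev_ord n.+1) xpredT F) claim => [|].
  congr (_ == _)%:R; apply/ffunP => l; rewrite ffunE.
  suff -> : l \in [seq rev_ord i | i <- index_enum 'I_n.+1] by rewrite muln1.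
  by apply/mapP; exists (rev_ord l); rewrite ?mem_index_enum ?rev_ordK.
rewrite pairwise_map.
have : pairwise ltn (map val (index_enum 'I_n.+1)).
  rewrite [index_enum _]unlock -enumT val_enum_ord -sorted_pairwise ?iota_ltn_sorted//.
  exact: ltn_trans.
rewrite pairwise_map; apply: sub_pairwise => i j /=.
by have := ltn_ord i; have := ltn_ord j; lia.
Qed.

Lemma hnorm2_gt0 m : 0 < q < 1 -> 0 < hnorm2 m.
Proof.
move=> /andP[q0 q1]; rewrite prodr_gt0// => i _; rewrite prodr_gt0// => j _.
by rewrite subr_gt0 -exprM -exprD exprn_ilt1 // ltW.
Qed.

Lemma star_adjoint (A : qop) a b : 0 < q < 1 ->
  A a b * (hnorm2 a)%:C = conjc (star A b a) * (hnorm2 b)%:C.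
Proof.
move=> q01; have /lt0r_neq0 hb := hnorm2_gt0 b q01.
have conjM (x y : R[i]) : conjc (x * y) = conjc x * conjc y by exact: rmorphM.
rewrite /star conjM conjcK conjc_real -mulrA; congr (_ * _).
by rewrite -[RHS]rmorphM/= divfK.
Qed.

Lemma star_z i : 0 < q < 1 -> star (z i) = zs i.
Proof.
move=> q01; apply/funext => a; apply/funext => b; rewrite /star/z/zs/wshift.
have [->|ba] := eqVneq b (up i a); last first.
  rewrite mul0r conjc0 mul0r; case: eqP => [ab|_]; last by rewrite mul0r.
  have [bi0|bi0] := posnP (b i); last by rewrite ab downK// eqxx in ba.
  by rewrite bi0 muln0 expr0 subrr mulr0 mulr0.
rewrite upK eqxx !mul1r conjc_real -rmorphM/= sum_up ltnn addn0.
congr (_ * _)%:C.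
have /lt0r_neq0 ha := hnorm2_gt0 a q01.
apply: (mulIf ha); rewrite divfK// /hnorm2 (bigD1 i)//= [in RHS](bigD1 i)//=.
rewrite ffunE eqxx addn1 {1}/qpoch big_ord_recr/= -/(qpoch _ _ _).
rewrite -exprM -exprD mulnS mulrA [(_ - _) * _]mulrC; congr (_ * _).
by apply: eq_bigr => l /negPf li; rewrite ffunE li addn0.
Qed.

End Ball.

Arguments radial {R} n q k.

(* Main.v *)
Require Import Defs.
From mathcomp Require Import all_boot all_order all_algebra.
From mathcomp Require Import finmap complex ring lra zify.
From mathcomp Require Import all_classical all_reals all_analysis.
Set Implicit Arguments.
Unset Strict Implicit.
Unset Printing Implicit Defensive.
Import Order.TTheory GRing.Theory Num.Theory.
Import numFieldNormedType.Exports.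
Local Open Scope classical_set_scope.
Local Open Scope ring_scope.
Local Open Scope complex_scope.

(** Why the formula holds.  Put p = q^2, t = q^(2 alpha) and N = n.+1.

    In the basis of the vectors z^b e_0 everything is explicit.  The monomial
    z^m sends z^b e_0 to q^(cross m b) z^(m + b) e_0, and the coefficient
    f_00 of a distribution f at the point of M attached to b is the diagonal
    entry f b b (coef00E).  Hence both integrals are weighted traces, and the
    scalar product of L^2(dm_alpha) is a weighted l^2 product of matrix
    entries (dotE).  A sequence of finite functions which is Cauchy and
    converges entrywise converges in norm (approxP); this turns the
    completion into an honest inner product space of matrices.

    Different monomials have disjoint supports, so they are orthogonal.  The
    squared norm of z^m is a sum over the N-tuples b; it factorizes into N
    q-binomial series, the j-th of which has the sum
    (p;p)_(m_j) / (x_j;p)_(m_j + 1), and the denominators are consecutive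
    blocks of one q-Pochhammer symbol.  This gives
    |z^m|^2 = (p;p)_m / (t p^(N+1);p)_|m|  (ztrunc_norm_cvg, dotL2_zmon).

    The projection of a finite f is therefore the polynomial with coordinates
    (f, z^m) / |z^m|^2 (proj_finite).  If f is diagonal, T_f multiplies each
    z^m by a number, Tr_q(T_f T_g) only sees the diagonal of g, and
    regrouping it along the fibres of (m, d) |-> m + d exhibits the symbol of
    T_f as a diagonal matrix (berezinE).

    For f = f_k the entry of the symbol at x is a sum over m + d = x and
    |m + b| = k of a constant times
    (t p;p)_N (t p^(N+1);p)_|m|^2 (t p)^(|b| + |d|),
    a polynomial in t (symbolX_eval).  Its coefficient of t only involves
    |b| + |d| <= 1.  The term b = d = 0 lives on |x| = k and gives f_k; the
    terms with b a unit vector live on |x| = k - 1 and give f_(k-1); those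
    with d a unit vector live on |x| = k + 1 and give f_(k+1).  In the last
    two cases the sum over the unit vectors telescopes (symbolX_coef1). *)

Import Normc.

(** * Multi-indices and sums over boxes *)

Section MultiIndices.
Variable n : nat.
Implicit Types (a b m d x : mi n) (i j l : 'I_n.+1).

Definition mdeg m : nat := (\sum_j m j)%N.
Definition msub a b : mi n := [ffun l => (a l - b l)%N].
Definition mle a b : bool := [forall l, (a l <= b l)%N].
Definition munit i : mi n := [ffun l => (l == i) : nat].

Definition tail m (i : nat) : nat := (\sum_(l < n.+1 | i <= l) m l)%N.

(** The exponent of q in z^m z^b = q^(cross m b) z^(m + b): each of the m_i
    factors z_i picks up one q for each z_l with l > i that it meets. *)
Definition cross m b : nat := (\sum_i m i * tail b i.+1)%N.

Lemma maddE a b l : (a + b) l = (a l + b l)%N.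
Proof. by rewrite ffunE. Qed.

Lemma mext a b : (forall l, a l = b l :> nat) -> a = b.
Proof. by move=> ab; apply/ffunP. Qed.

Lemma maddIr d : injective (fun a => a + d).
Proof. by move=> a b /ffunP ab; apply/ffunP => l; have := ab l; rewrite !maddE => /addIn. Qed.

Lemma mleP a b : reflect (forall l, (a l <= b l)%N) (mle a b).
Proof. exact: forallP. Qed.

Lemma mdegD a b : mdeg (a + b) = (mdeg a + mdeg b)%N.
Proof. by rewrite /mdeg -big_split/=; apply: eq_bigr => l _; rewrite maddE. Qed.

Lemma mdeg0 : mdeg 0 = 0%N.
Proof. by rewrite /mdeg big1// => l _; rewrite ffunE. Qed.

Lemma mdeg_munit i : mdeg (munit i) = 1%N.
Proof.
rewrite /mdeg (bigD1 i)//= big1 ?ffunE ?eqxx// => l /negPf li.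
by rewrite ffunE li.
Qed.

Lemma tailS m i : tail m i = (m i + tail m i.+1)%N.
Proof.
rewrite /tail (bigD1 i)//=; congr addn; apply: eq_bigl => l.
by rewrite andbC eq_sym ltn_neqAle.
Qed.

Lemma tail0 m : tail m 0 = mdeg m.
Proof. by rewrite /tail/mdeg; apply: eq_bigl. Qed.

Lemma tailsE m i : tails m i = tail m i.
Proof. by rewrite ffunE. Qed.

Lemma tails_inj : injective (@tails n).
Proof.
move=> a b /ffunP ab.
have tl k : tail a k = tail b k.
  have [kn|nk] := ltnP k n.+1; first by have := ab (Ordinal kn); rewrite !tailsE.
  by rewrite /tail !big1// => l; have := ltn_ord l; lia.
apply/ffunP => l; apply: (@addIn (tail b l.+1)); rewrite -tailS -{1}tl -tl.
by rewrite -tailS.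
Qed.

(** Taking successive differences inverts [tails]; this is what lets a sum over
    the points of M be rewritten as a sum over the basis of H. *)
Lemma tails_bij : set_bij [set: mi n] (@Pn n) (@tails n).
Proof.
split.
- move=> m _ i j ij; rewrite !tailsE /tail [leqRHS](bigID (fun l : 'I_n.+1 => (j <= l)%N))/=.
  apply: leq_trans (leq_addr _ _); rewrite leq_eqVlt; apply/orP; left; apply/eqP.
  by apply: eq_bigl => l; lia.
- by move=> a b _ _; apply: tails_inj.
move=> k Pk /=.
(* Extending k by zero makes its last component a difference as well. *)
pose k' (i : nat) := if insub i is Some j then k j else 0%N.
exists [ffun i : 'I_n.+1 => (k' i - k' i.+1)%N] => //.
apply/ffunP => i; rewrite tailsE /tail.
have -> : k i = k' i by rewrite /k' valK.
have k'_le (s : nat) : (k' s.+1 <= k' s)%N.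
  rewrite /k'; case: insubP => [u _ us|//].
  have sn : (s < n.+1)%N by apply: ltnW; rewrite -us; apply: (ltn_ord u).
  rewrite insubT/=.
  by apply: Pk; rewrite -[nat_of_ord u]/(\val u) us /= leqnSn.
transitivity (\sum_(i <= s < n.+1) (k' s - k' s.+1))%N.
  by rewrite big_geq_mkord; apply: eq_bigr => l _; rewrite ffunE.
have tel r : (i + r <= n.+1)%N -> (\sum_(i <= s < i + r) (k' s - k' s.+1) + k' (i + r) = k' i)%N.
  elim: r => [|r IH] ir; first by rewrite addn0 big_geq.
  rewrite addnS big_nat_recr/= ?leq_addr// -addnA subnK//.
  by apply: IH; lia.
have := tel (n.+1 - i)%N; have := ltn_ord i => in1.
rewrite subnKC; last lia.
move=> <-//.
by rewrite [X in (_ + X)%N]/k' insubN ?addn0// ltnn.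
Qed.

Lemma cross0m b : cross 0 b = 0%N.
Proof. by rewrite /cross big1// => l _; rewrite ffunE. Qed.

Lemma crossm0 b : cross b 0 = 0%N.
Proof. by rewrite /cross big1// => l _; rewrite /tail big1 ?muln0// => l' _; rewrite ffunE. Qed.

Definition mhead m (j : nat) : nat := (\sum_(i < n.+1 | i < j) m i)%N.

Lemma mheadS m (j : 'I_n.+1) : mhead m j.+1 = (mhead m j + m j)%N.
Proof.
rewrite /mhead (bigD1 j)//= addnC; congr addn; apply: eq_bigl => l.
by rewrite andbC -val_eqE/=; lia.
Qed.

Lemma mhead_max m : mhead m n.+1 = mdeg m.
Proof. by apply: eq_bigl => l; rewrite ltn_ord. Qed.

(** The same double sum, with the index of b on the outside: this is the form
    in which the contribution of each b_j separates. *)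
Lemma cross_mhead m b : cross m b = (\sum_(j < n.+1) b j * mhead m j)%N.
Proof.
rewrite /cross; under eq_bigr do rewrite /tail big_distrr/= big_mkcond.
rewrite exchange_big; apply: eq_bigr => l _; rewrite /mhead big_distrr/= [RHS]big_mkcond.
by apply: eq_bigr => i _; case: ifP => // _; rewrite mulnC.
Qed.

(** Sums over multi-indices with finite support are computed on boxes: these
    are plain finite sums, which can be exchanged without side conditions, and
    a sum over a box of a product of functions of the coordinates factorizes. *)
Definition box (K : nat) : seq (mi n) :=
  [seq [ffun l => (f l : nat)] | f : {ffun 'I_n.+1 -> 'I_K}].

Lemma mem_box K m : (m \in box K) = [forall l, (m l < K)%N].
Proof.
apply/mapP/forallP => [[f _ -> l]|mK]; first by rewrite ffunE.
exists [ffun l => Ordinal (mK l)]; rewrite ?mem_enum//.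
by apply/ffunP => l; rewrite !ffunE.
Qed.

Lemma box_uniq K : uniq (box K).
Proof.
rewrite map_inj_uniq ?enum_uniq// => f g /ffunP fg; apply/ffunP => l.
by have := fg l; rewrite !ffunE => /val_inj.
Qed.

Lemma sub_box K L m : (K <= L)%N -> m \in box K -> m \in box L.
Proof.
by move=> KL; rewrite !mem_box => /forallP mK; apply/forallP => l; apply: leq_trans (mK l) KL.
Qed.

Lemma mdeg_box K m : (mdeg m < K)%N -> m \in box K.
Proof.
rewrite mem_box => mK; apply/forallP => l; apply: leq_ltn_trans mK.
by rewrite /mdeg (bigD1 l)//= leq_addr.
Qed.

Lemma box_add K a b : a + b \in box K -> (a \in box K) && (b \in box K).
Proof.
rewrite !mem_box => /forallP ab; apply/andP; split; apply/forallP => l;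
  by have := ab l; rewrite maddE; lia.
Qed.

Lemma box_finite (A : set (mi n)) : finite_set A -> exists K, A `<=` [set` box K].
Proof.
move/finite_fsetP => [s ->]; exists (\sum_(m <- s) mdeg m).+1 => m /= ms.
by apply: mdeg_box; rewrite ltnS (big_rem m)//= leq_addr.
Qed.

Lemma finite_box K : finite_set [set` box K].
Proof. exact: finite_seq. Qed.

Lemma big_box (V : nmodType) K (F : mi n -> V) :
  (forall m, m \notin box K -> F m = 0) ->
  \sum_(m \in [set: mi n]) F m = \sum_(m <- box K) F m.
Proof.
move=> F0; rewrite (fsbigE (box K)) ?box_uniq//.
  by apply: eq_bigl => m; rewrite in_setT.
by move=> m _; apply: F0.
Qed.

Lemma big_box_widen (V : nmodType) K L (F : mi n -> V) : (K <= L)%N ->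
  (forall m, m \notin box K -> F m = 0) ->
  \sum_(m <- box L) F m = \sum_(m <- box K) F m.
Proof.
move=> KL F0; rewrite -!big_box// => m mL; apply: F0.
by apply: contra mL; apply: sub_box.
Qed.

Lemma big_box1 (V : nmodType) K x (F : mi n -> V) : x \in box K ->
  (forall m, m != x -> F m = 0) -> \sum_(m <- box K) F m = F x.
Proof.
move=> xK F0; rewrite (bigD1_seq x) ?box_uniq//= big1 ?addr0//.
Qed.

End MultiIndices.

(** * The matrices of the monomials *)

Section Entries.
Variables (R : realType) (n : nat) (q : R).
Hypothesis q01 : 0 < q < 1.
Local Notation C := R[i]^o.
Implicit Types (a b m d x : mi n) (i j l : 'I_n.+1).

Let q0 : 0 < q. Proof. by case/andP: q01. Qed.
Let qn0 : q != 0. Proof. exact: lt0r_neq0. Qed.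

Lemma eq_wshift s s' c c' : s =1 s' -> c =1 c' ->
  wshift s c = wshift s' c' :> qop R n.
Proof. by move=> /funext-> /funext->. Qed.

Lemma iter_zE i k : iter k (qmul (z q i)) (qone R (n:=n)) =
  wshift (fun b => [ffun l => b l + k * (l == i)]%N)
    (fun b => q ^+ (k * tail b i.+1)).
Proof.
elim: k => [|k IH].
  by rewrite qone_wshift; apply: eq_wshift => // b; apply/ffunP => l; rewrite ffunE addn0.
rewrite iterS IH wshiftM; apply: eq_wshift => b.
  by apply/ffunP => l; rewrite !ffunE; case: eqP => _; lia.
rewrite -exprD mulSn; congr (_ ^+ (_ + _)); apply: eq_bigr => l il.
by rewrite ffunE; case: eqP il => [->|_ _]; rewrite ?ltnn// muln0 addn0.
Qed.

(** A power of z_i applied after the smaller-index factors still sees the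
    original components b_l, l > i, since those factors only raised components
    of smaller index.  Hence the exponents add up to [cross]. *)
Lemma zmonE m : zmon q m = wshift (fun b => m + b) (fun b => q ^+ cross m b).
Proof.
pose F j := iter (m j) (qmul (z q j)) (qone R (n:=n)).
have claim (s : seq 'I_n.+1) : pairwise (fun i j : 'I_n.+1 => (j < i)%N) s ->
    \big[qmul (n:=n)/qone R (n:=n)]_(j <- s) F j =
    wshift (fun b => [ffun l => b l + m l * (l \in s)]%N)
      (fun b => q ^+ (\sum_(j <- s) m j * tail b j.+1)).
  elim: s => [|j s IH]/=.
    move=> _; rewrite big_nil qone_wshift; apply: eq_wshift => b; last by rewrite big_nil.
    by apply/ffunP => l; rewrite !ffunE muln0 addn0.
  move=> /andP[/allP js /IH{}IH]; rewrite big_cons IH /F iter_zE wshiftM.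
  apply: eq_wshift => b.
    apply/ffunP => l; rewrite !ffunE inE.
    case: eqP => [->|_]; last by rewrite muln0 addn0.
    case: (boolP (j \in s)) => [/js|_]; first by rewrite ltnn.
    by rewrite muln0 addn0.
  rewrite -exprD big_cons; congr (_ ^+ (_ * _ + _)); apply: eq_bigr => l jl.
  rewrite ffunE; case: (boolP (l \in s)) => [/js|_]; first by rewrite ltnNge (ltnW jl).
  by rewrite muln0 addn0.
rewrite /zmon -(big_map (@rev_ord n.+1) xpredT F) claim => [|].
  apply: eq_wshift => b; first apply/ffunP => l.
    rewrite !ffunE.
    suff -> : l \in [seq rev_ord i | i <- index_enum 'I_n.+1] by rewrite muln1 addnC.
    by apply/mapP; exists (rev_ord l); rewrite ?mem_index_enum ?rev_ordK.
  rewrite big_map /cross; congr (_ ^+ _).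
  by rewrite [RHS](reindex_inj rev_ord_inj).
rewrite pairwise_map.
have : pairwise ltn (map val (index_enum 'I_n.+1)).
  rewrite [index_enum _]unlock -enumT val_enum_ord -sorted_pairwise ?iota_ltn_sorted//.
  exact: ltn_trans.
rewrite pairwise_map; apply: sub_pairwise => i j /=.
by have := ltn_ord i; have := ltn_ord j; lia.
Qed.

Lemma zmon_entry m b : zmon q m (m + b) b = (q ^+ cross m b)%:C.
Proof. by rewrite zmonE /wshift eqxx mul1r. Qed.

Lemma zmon_entry0 m a b : a != m + b -> zmon q m a b = 0.
Proof. by rewrite zmonE /wshift => /negPf ->; rewrite mul0r. Qed.

(** The exact coefficient of a product of the z_j^* is never used, only where
    it vanishes. *)
Definition lowers (A : qop R n) m := exists2 c,
  A = wshift (fun b => msub b m) c & forall b, (c b != 0) = mle m b.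

Lemma lowers1 : lowers (qone R (n:=n)) 0.
Proof.
exists (fun=> 1) => [|b].
  by rewrite qone_wshift; apply: eq_wshift => // b; apply/ffunP => l; rewrite !ffunE subn0.
by rewrite oner_neq0; apply/esym/mleP => l; rewrite ffunE.
Qed.

Lemma lowersM (A B : qop R n) a b : lowers A a -> lowers B b -> lowers (qmul A B) (a + b).
Proof.
move=> [c -> cP] [c' -> c'P]; rewrite wshiftM.
eexists.
  apply: eq_wshift => x; last reflexivity.
  by apply/ffunP => l; rewrite [RHS]ffunE maddE !ffunE addnC subnDA.
move=> x; rewrite mulf_eq0 negb_or cP c'P.
apply/andP/mleP => [[/mleP ax /mleP bx] l|abx].
  by have := ax l; have := bx l; rewrite maddE ffunE; lia.
by split; apply/mleP => l; have := abx l; rewrite maddE ?ffunE; lia.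
Qed.

Lemma lowers_zs i : lowers (zs q i) (munit i).
Proof.
rewrite /zs; eexists.
  by apply: eq_wshift => b; last reflexivity; apply/ffunP => l; rewrite !ffunE.
move=> b /=; rewrite mulf_eq0 expf_eq0 (negPf qn0) andbF/=.
have q1 : 0 <= q < 1 by case/andP: q01 => /ltW -> ->.
apply/idP/mleP => [H l|/(_ i)]; last first.
  rewrite ffunE eqxx => bi; rewrite lt0r_neq0// subr_gt0.
  by case/andP: q1 => q0' q1; rewrite exprn_ilt1// -lt0n muln_gt0.
rewrite ffunE; case: eqP => // ->; rewrite lt0n; apply: contra H => /eqP ->.
by rewrite muln0 expr0 subrr.
Qed.

Lemma lowers_zsmon m : lowers (zsmon q m) m.
Proof.
have li i k : lowers (iter k (qmul (zs q i)) (qone R (n:=n))) [ffun l => k * (l == i)]%N.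
  elim: k => [|k IH].
    have -> : [ffun l => 0 * (l == i)]%N = 0 :> mi n by apply/ffunP => l; rewrite !ffunE.
    exact: lowers1.
  have -> : [ffun l => k.+1 * (l == i)]%N = munit i + [ffun l => k * (l == i)]%N :> mi n.
    by apply/ffunP => l; rewrite !ffunE; lia.
  by rewrite iterS; apply: lowersM => //; apply: lowers_zs.
have : lowers (zsmon q m) (\sum_i [ffun l => m i * (l == i)]%N).
  rewrite /zsmon; elim/big_ind2: _ => //; first exact: lowers1.
  by move=> *; apply: lowersM.
congr lowers; apply/ffunP => l; rewrite sum_ffunE (bigD1 l)//= ffunE eqxx muln1 big1 ?addr0//.
by move=> i /negPf il; rewrite ffunE eq_sym il muln0.
Qed.

Lemma point_inj : injective (@Defs.point R n q).
Proof.
move=> a b ab; apply/ffunP => l; have := congr1 (fun f => f l) ab; rewrite /Defs.point.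
have q1 : q != 1 by rewrite lt_eqF//; case/andP: q01.
by move/(ieexprIn q0 q1)/eqP; rewrite eqn_pmul2l// => /eqP.
Qed.

End Entries.

(** * Normally ordered coefficients *)

Section Coefficients.
Variables (R : realType) (n : nat) (q : R).
Hypothesis q01 : 0 < q < 1.
Local Notation C := R[i]^o.
Implicit Types (a b m d x : mi n).

Let q0 : 0 < q. Proof. by case/andP: q01. Qed.
Let qn0 : q != 0. Proof. exact: lt0r_neq0. Qed.

Definition lower_coef m b : C := zsmon q m (msub b m) b.

Lemma zsmonE m a b : zsmon q m a b = (a == msub b m)%:R * lower_coef m b.
Proof.
rewrite /lower_coef; have [c -> _] := lowers_zsmon q01 m; by rewrite /wshift eqxx mul1r.
Qed.

Lemma lower_coef_eq0 m b : (lower_coef m b != 0) = mle m b.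
Proof.
rewrite /lower_coef; have [c -> cP] := lowers_zsmon q01 m; rewrite /wshift eqxx mul1r.
by rewrite -cP fmorph_eq0.
Qed.

Definition mmin a b : mi n := msub b (msub b a).

Lemma mmin_addl a b : msub a b + mmin a b = a.
Proof. by apply: mext => l; rewrite maddE /mmin !ffunE; lia. Qed.

Lemma mmin_addr a b : msub b a + mmin a b = b.
Proof. by apply: mext => l; rewrite maddE /mmin !ffunE; lia. Qed.

Lemma decomp_term (i j : mi n) g a b :
  qmul (zmon q i) (qmul (fun_y q g) (zsmon q j)) a b =
  (a == i + msub b j)%:R *
   ((q ^+ cross i (msub b j))%:C * g (Defs.point q (tails (msub b j))) * lower_coef j b).
Proof.
rewrite /qmul (fsum1 (b := msub b j)) => [|c cb].
  rewrite (fsum1 (b := msub b j)) => [|c cb].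
    by rewrite /fun_y eqxx zsmonE eqxx !mul1r zmonE// /wshift -!mulrA.
  by rewrite /fun_y eq_sym (negPf cb) !mul0r.
rewrite [X in _ * X](fsum1 (b := msub b j)) => [|c' cb'].
  by rewrite /fun_y (negPf cb) !mul0r mulr0.
by rewrite zsmonE (negPf cb') mul0r mulr0.
Qed.

(** The constraint i x j = 0 leaves exactly one term contributing to the entry
    (a, b): i and j must be the positive and negative parts of a - b, and the
    point at which the coefficient is evaluated is the minimum of a and b. *)
Lemma decomp_sum (c : mi n -> mi n -> ('I_n.+1 -> R) -> C) a b :
  \sum_(ij \in [set ij : mi n * mi n | forall l, (ij.1 l * ij.2 l = 0)%N])
      qmul (zmon q ij.1) (qmul (fun_y q (c ij.1 ij.2)) (zsmon q ij.2)) a b =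
  (q ^+ cross (msub a b) (mmin a b))%:C *
    c (msub a b) (msub b a) (Defs.point q (tails (mmin a b))) * lower_coef (msub b a) b.
Proof.
rewrite -(fsbig_widen [set (msub a b, msub b a)]).
- by rewrite fsbig_set1 decomp_term mmin_addl eqxx mul1r.
- move=> ? -> l /=; rewrite !ffunE.
  by have [/eqP ->|/ltnW/eqP ->] := leqP (a l) (b l); rewrite ?muln0.
move=> [i j] [/= ij0 ij]; rewrite decomp_term; case: eqP => [aE|]; last by rewrite mul0r.
have [|/negPf H] := boolP (mle j b); last first.
  by move/negbT: H; rewrite -lower_coef_eq0 negbK => /eqP ->; rewrite !mulr0.
move=> /mleP jb; case: ij; congr pair; apply: mext => l; have := ij0 l; have := jb l;
  rewrite ffunE aE maddE ffunE; case: (i l) => [|?]; case: (j l) => [|?]; lia.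
Qed.

Lemma qdecompE (f : qop R n) c : qdecomp q f c <-> forall a b, f a b =
  (q ^+ cross (msub a b) (mmin a b))%:C *
    c (msub a b) (msub b a) (Defs.point q (tails (mmin a b))) * lower_coef (msub b a) b.
Proof. by split=> H a b; rewrite H; [|apply: esym]; apply: decomp_sum. Qed.

(** By [qdecompE] each value c_{i,j}(y) is determined by a single matrix entry
    and its prefactor is nonzero, so the entry can be divided by it. *)
Lemma decomp_exists (f : qop R n) : exists c, qdecomp q f c.
Proof.
(* The multi-index attached to a point of M. *)
pose unpt y : mi n := xget 0 [set d | Defs.point q (tails d) = y].
have unptK d : unpt (Defs.point q (tails d)) = d.
  rewrite /unpt; case: xgetP => [x _ /= /(point_inj q01)/tails_inj //|/(_ d) H].
  by exfalso; apply: H.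
exists (fun i j y => let d := unpt y in
  f (i + d) (j + d) / ((q ^+ cross i d)%:C * lower_coef j (j + d))).
apply/qdecompE => a b; rewrite /= unptK mmin_addl mmin_addr.
have q'0 : (q ^+ cross (msub a b) (mmin a b))%:C != 0 :> R[i].
  by rewrite fmorph_eq0 expf_neq0.
have l0 : lower_coef (msub b a) b != 0.
  by rewrite lower_coef_eq0; apply/mleP => l; rewrite ffunE leq_subr.
by rewrite [RHS]mulrAC [RHS]mulrC divfK// mulf_neq0.
Qed.

(** On the diagonal a = b both i and j vanish, and the monomials are 1. *)
Lemma coef00E (f : qop R n) b : coef00 q f (Defs.point q (tails b)) = f b b.
Proof.
rewrite /coef00 /qcoef; case: xgetP => [c _ /= /qdecompE cf|nf]; last first.
  by have [c /nf] := decomp_exists f.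
have bb : msub b b = 0 by apply: mext => l; rewrite !ffunE subnn.
have mm : mmin b b = b by apply: mext => l; rewrite /mmin !ffunE; lia.
rewrite cf bb mm.
have z0 : [ffun=> 0%N] = 0 :> mi n by apply: mext => l; rewrite !ffunE.
rewrite z0 cross0m mul1r.
have -> : lower_coef 0 b = 1; last by rewrite mulr1.
rewrite /lower_coef /zsmon.
have -> : \big[qmul (n:=n)/qone R (n:=n)]_(j < n.+1)
    iter ((GRing.zero : mi n) j) (qmul (zs q j)) (qone R (n:=n)) = qone R (n:=n).
  elim/big_ind: _ => // [A B -> ->|i _]; last by rewrite ffunE.
  by rewrite qone_wshift wshiftM; apply: eq_wshift => // x; rewrite mulr1.
by rewrite /qone (_ : msub b 0 = b) ?eqxx//; apply: mext => l; rewrite !ffunE subn0.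
Qed.

Lemma int_sum (f : qop R n) (w : mi n -> C) :
  \sum_(k \in @Pn n) coef00 q f (Defs.point q k) * w k =
  \sum_(b \in [set: mi n]) f b b * w (tails b).
Proof.
rewrite (reindex_fsbig (@tails n) setT); last exact: tails_bij.
by apply: eq_fsbigr => b _; rewrite coef00E.
Qed.

(** The factor common to the densities of both integrals. *)
Definition rho b : R := \prod_(j < n) q ^+ (2 * tails b (lift ord0 j)).

Lemma rhoE b : rho b = \prod_(j < n.+1) q ^+ (2 * (j * b j)).
Proof.
rewrite /rho -!(big_morph (fun k => q ^+ k) (exprD q) (expr0 q)); congr (_ ^+ _).
rewrite -!big_distrr/=; congr (_ * _)%N.
under eq_bigr do rewrite tailsE /tail big_mkcond/=.
rewrite exchange_big/=; apply: eq_bigr => l _; rewrite -big_mkcond/= sum_nat_const; congr (_ * _)%N.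
rewrite -sum1_card; transitivity (\sum_(j < n | (j < l)%N) 1)%N; first exact: eq_bigl.
rewrite -(big_mkord (fun j => (j < l)%N) (fun=> 1%N)) -(big_nat_widen _ _ _ xpredT) -1?ltnS//.
by rewrite sum_nat_const_nat; lia.
Qed.

Lemma rhoD a b : rho (a + b) = rho a * rho b.
Proof.
rewrite !rhoE -big_split; apply: eq_bigr => l _ /=.
by rewrite maddE mulnDr mulnDr exprD.
Qed.

Lemma rho_gt0 b : 0 < rho b.
Proof. by rewrite prodr_gt0// => j _; rewrite exprn_gt0. Qed.

End Coefficients.

(** * Moduli and limits of complex numbers *)

Section ComplexModulus.
Variable R : realType.
Implicit Types (x y : R[i]) (e s : R).

(** The squared modulus; opaque, so that products of squared moduli and
    weights are rearranged without breaking up the square. *)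
Definition nsq x : R := locked (normc x ^+ 2).

Lemma nsqE x : nsq x = normc x ^+ 2.
Proof. by rewrite /nsq -lock. Qed.

Lemma normc_norm x : `|x| = (normc x)%:C.
Proof. by []. Qed.

Lemma normc_ge0 x : 0 <= normc x.
Proof. by rewrite -lecR -normc_norm normr_ge0. Qed.

Lemma normcD_le x y : normc (x + y) <= normc x + normc y.
Proof. exact: le_normcD. Qed.

Lemma normc_opp x : normc (- x) = normc x.
Proof. exact: normcN. Qed.

Lemma normc_real e : normc e%:C = `|e|.
Proof. by rewrite /normc/= expr0n/= addr0 sqrtr_sqr. Qed.

Lemma normc_conj x : normc (conjc x) = normc x.
Proof. by case: x => a b /=; rewrite sqrrN. Qed.

Lemma normc_Re x : `|complex.Re x| <= normc x.
Proof. by rewrite -lecR -normc_norm; apply: normc_ge_Re. Qed.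

Lemma normc_Im x : `|complex.Im x| <= normc x.
Proof.
case: x => a b /=; rewrite -sqrtr_sqr ler_sqrt; last by rewrite addr_ge0 ?sqr_ge0.
by rewrite lerDr sqr_ge0.
Qed.

Lemma normc_le_ReIm x : normc x <= `|complex.Re x| + `|complex.Im x|.
Proof.
case: x => a b /=; rewrite -[leRHS]ger0_norm ?addr_ge0// -sqrtr_sqr ler_sqrt ?sqr_ge0//.
rewrite sqrrD !real_normK ?num_real// addrAC lerDl mulrn_wge0// mulr_ge0//.
Qed.

Lemma nsq_ge0 x : 0 <= nsq x.
Proof. by rewrite nsqE sqr_ge0. Qed.

Lemma nsq0 : nsq 0 = 0.
Proof. by rewrite nsqE normc0 expr0n. Qed.

Lemma nsq_eq0 x : nsq x = 0 -> x = 0.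
Proof. by rewrite nsqE => /eqP; rewrite sqrf_eq0 => /eqP/eq0_normc. Qed.

Lemma nsqM x y : nsq (x * y) = nsq x * nsq y.
Proof. by rewrite !nsqE normcM exprMn. Qed.

Lemma nsqN x : nsq (- x) = nsq x.
Proof. by rewrite !nsqE normc_opp. Qed.

Lemma nsqD_le x y : nsq (x + y) <= 2 * nsq x + 2 * nsq y.
Proof.
rewrite !nsqE; have := normcD_le x y; have := normc_ge0 (x + y).
move: (normc x) (normc y) (normc (x + y)) => u v w w0 wuv.
have : w ^+ 2 <= (u + v) ^+ 2 by rewrite !expr2 ler_pM.
by have := sqr_ge0 (u - v); nra.
Qed.

Lemma conjcM x y : conjc (x * y) = conjc x * conjc y.
Proof. exact: rmorphM. Qed.

Lemma conjcB x y : conjc (x - y) = conjc x - conjc y.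
Proof. exact: raddfB. Qed.

Lemma mul_conjc x : x * conjc x = (nsq x)%:C.
Proof. by rewrite -sqr_normc normc_norm nsqE -rmorphXn. Qed.

(** A weak form of the Cauchy-Schwarz inequality that needs no square roots
    and is stable under sums. *)
Lemma young x y s : 0 < s -> normc (x * conjc y) <= s * nsq x + nsq y / s.
Proof.
move=> s0; rewrite normcM normc_conj !nsqE.
rewrite -(ler_pM2l s0) mulrDr [s * (_ / s)]mulrC divfK ?lt0r_neq0//.
have := normc_ge0 x; have := normc_ge0 y; move: (normc x) (normc y) => u v v0 u0.
have := sqr_ge0 (s * u - v); have : 0 <= s * u * v by rewrite !mulr_ge0// ltW.
nra.
Qed.

Lemma posC (e : R[i]) : 0 < e -> exists2 d : R, 0 < d & e = d%:C.
Proof.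
case: e => a b; rewrite ltcE/= => /andP[/eqP-> a0].
by exists a.
Qed.

Lemma cvgC (u : nat -> R[i]^o) (l : R[i]^o) :
  (u @ \oo --> l) <->
  forall e, 0 < e -> exists k0, forall k, (k0 <= k)%N -> normc (u k - l) < e.
Proof.
split=> [/cvgrPdistC_lt ul e e0|ul].
  have e0' : 0 < e%:C :> R[i] by rewrite ltcR.
  have [k0 _ k0P] := ul _ e0'; exists k0 => k kk.
  by have := k0P k kk; rewrite /= normc_norm ltcR.
apply/cvgrPdistC_lt => e /posC[d d0 ->].
have [k0 k0P] := ul _ d0; exists k0 => // k /= kk.
by rewrite normc_norm ltcR k0P.
Qed.

Lemma cvgRP (u : nat -> R) (l : R) :
  (u @ \oo --> l) <->
  forall e, 0 < e -> exists k0, forall k, (k0 <= k)%N -> `|u k - l| < e.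
Proof.
split=> [/cvgrPdistC_lt ul e e0|ul].
  by have [k0 _ k0P] := ul _ e0; exists k0 => k kk; exact: k0P.
apply/cvgrPdistC_lt => e e0.
by have [k0 k0P] := ul _ e0; exists k0 => // k /= kk; exact: k0P.
Qed.

Lemma cauchyR (u : nat -> R) :
  (forall e, 0 < e -> exists k0, forall k l, (k0 <= k)%N -> (k0 <= l)%N ->
    `|u k - u l| < e) -> exists l : R, u @ \oo --> l.
Proof.
move=> uc; suff : cvg (u @ \oo) by move=> c; exists (lim (u @ \oo)).
apply/cauchy_cvgP/cauchy_exP => e e0; have [k0 k0P] := uc _ e0.
exists (u k0); exists k0 => // k /= kk.
by rewrite /ball/= k0P.
Qed.

(** Completeness of the complex numbers, through real and imaginary parts. *)
Lemma cauchyC (u : nat -> R[i]^o) :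
  (forall e, 0 < e -> exists k0, forall k l, (k0 <= k)%N -> (k0 <= l)%N ->
    normc (u k - u l) < e) -> exists l : R[i]^o, u @ \oo --> l.
Proof.
move=> uc.
have [a ua] : exists a : R, (fun k => complex.Re (u k)) @ \oo --> a.
  apply: cauchyR => e /uc[k0 k0P]; exists k0 => k l kk ll.
  by apply: le_lt_trans (k0P k l kk ll); rewrite -raddfB normc_Re.
have [b ub] : exists b : R, (fun k => complex.Im (u k)) @ \oo --> b.
  apply: cauchyR => e /uc[k0 k0P]; exists k0 => k l kk ll.
  by apply: le_lt_trans (k0P k l kk ll); rewrite -raddfB normc_Im.
exists (Complex a b); apply/cvgC => e e0.
have e20 : 0 < e / 2 by rewrite divr_gt0.
have /cvgRP/(_ _ e20)[k1 k1P] := ua; have /cvgRP/(_ _ e20)[k2 k2P] := ub.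
exists (maxn k1 k2) => k; rewrite geq_max => /andP[/k1P ak /k2P bk].
apply: le_lt_trans (normc_le_ReIm _) _; rewrite !raddfB/=.
by rewrite [e]splitr ltrD.
Qed.

Lemma cvgC_unique (u : nat -> R[i]^o) (l l' : R[i]^o) :
  (u @ \oo --> l) -> (u @ \oo --> l') -> l = l'.
Proof.
move=> /cvgC ul /cvgC ul'; apply/eqP; rewrite -subr_eq0; apply/eqP/eq0_normc/eqP.
rewrite -[_ == _]negbK; apply/negP => d0.
have {d0} d0 : 0 < normc (l - l') / 2 by rewrite divr_gt0// lt_def d0 normc_ge0.
have [k1 k1P] := ul _ d0; have [k2 k2P] := ul' _ d0.
have := k1P (maxn k1 k2) (leq_maxl _ _); have := k2P (maxn k1 k2) (leq_maxr _ _).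
set x := u _ => h1 h2.
have : normc (l - l') <= normc (x - l') + normc (x - l).
  rewrite -[normc (x - l)]normc_opp; apply: le_trans (normcD_le _ _).
  by rewrite le_eqVlt; apply/orP; left; apply/eqP; congr normc; rewrite opprB [RHS]addrC subrKA.
by rewrite leNgt [normc (l - l')]splitr ltrD.
Qed.

End ComplexModulus.

(** * Integrals and scalar products of finite functions *)

Section FiniteSums.
Variables (R : realType) (n : nat) (q : R).
Hypothesis q01 : 0 < q < 1.
Local Notation C := R[i]^o.
Local Notation box := (box n).
Local Notation qop := (qop R n).
Implicit Types (a b m d x : mi n) (f g : qop).

Let q0 : 0 < q. Proof. by case/andP: q01. Qed.
Let q1 : q < 1. Proof. by case/andP: q01. Qed.

Definition boxed K f := forall a b, f a b != 0 -> (a \in box K) && (b \in box K).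

Lemma boxed_widen K L f : (K <= L)%N -> boxed K f -> boxed L f.
Proof. by move=> KL fK a b /fK/andP[aK bK]; rewrite !(sub_box KL). Qed.

Lemma finite_opP f : finite_op f <-> exists K, boxed K f.
Proof.
split=> [fin|[K fK]]; last first.
  apply: (@sub_finite_set _ _ ([set` box K] `*` [set` box K])).
    by move=> [a b] /= /fK/andP[].
  by apply: finite_setX; exact: finite_box.
have [K1 h1] : exists K,
    [set ab.1 | ab in [set ab : mi n * mi n | f ab.1 ab.2 != 0]] `<=` [set` box K].
  by apply: box_finite; apply: finite_image.
have [K2 h2] : exists K,
    [set ab.2 | ab in [set ab : mi n * mi n | f ab.1 ab.2 != 0]] `<=` [set` box K].
  by apply: box_finite; apply: finite_image.
exists (maxn K1 K2) => a b fab; apply/andP; split.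
  by apply: (@sub_box n K1); [exact: leq_maxl|apply: h1; exists (a, b)].
by apply: (@sub_box n K2); [exact: leq_maxr|apply: h2; exists (a, b)].
Qed.

Lemma boxed_l K f a b : boxed K f -> a \notin box K -> f a b = 0.
Proof. by move=> fK aK; apply/eqP; apply: contraNT aK => /fK/andP[]. Qed.

Lemma boxed_r K f a b : boxed K f -> b \notin box K -> f a b = 0.
Proof. by move=> fK bK; apply/eqP; apply: contraNT bK => /fK/andP[]. Qed.

Lemma qmul_box_r K (A f : qop) a b : boxed K f ->
  qmul A f a b = \sum_(c <- box K) A a c * f c b.
Proof. by move=> fK; apply: big_box => c /(boxed_l b fK) ->; rewrite mulr0. Qed.

Definition wnu b : R := q ^- (2 * n.+1 * mdeg b) * rho q b.

Lemma wnu_gt0 b : 0 < wnu b.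
Proof. by rewrite mulr_gt0 ?rho_gt0// invr_gt0 exprn_gt0. Qed.

Lemma int_nuE K f : (forall b, b \notin box K -> f b b = 0) ->
  int_nu q f = (qpoch (q ^+ 2) (q ^+ 2) n.+1)%:C *
    \sum_(b <- box K) f b b * (wnu b)%:C.
Proof.
move=> fK; rewrite /int_nu; congr (_ * _).
rewrite (int_sum q01 f (fun k =>
  (q ^- (2 * n.+1 * k ord0) * \prod_(j < n) q ^+ (2 * k (lift ord0 j)))%:C)).
rewrite (big_box (K := K)) => [|b /fK ->]; last by rewrite mul0r.
by apply: eq_bigr => b _; rewrite tailsE tail0.
Qed.

Variable alpha : R.
Hypothesis alpha0 : 0 < alpha.

Definition tq : R := q `^ (2 * alpha).

Lemma tq_gt0 : 0 < tq. Proof. exact: powR_gt0. Qed.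

Lemma tq_lt1 : tq < 1.
Proof.
have : q `^ (2 * alpha) < 1 `^ (2 * alpha).
  by rewrite gt0_ltr_powR ?mulr_gt0// nnegrE ltW.
by rewrite powR1.
Qed.

Lemma powR_tq2 : q `^ (2 * alpha + 2) = tq * q ^+ 2.
Proof.
rewrite powRD; last by rewrite (gt_eqF q0) implybT.
by rewrite -[X in _ * q `^ X]/(2%:R) powR_mulrn// ltW.
Qed.

Lemma powR_tqX k : q `^ (2 * k%:R * (alpha + 1)) = (tq * q ^+ 2) ^+ k.
Proof.
rewrite -powR_tq2 -powR_mulrn ?powR_ge0// -powRrM; congr (_ `^ _); ring.
Qed.

Definition mu b : R := (tq * q ^+ 2) ^+ mdeg b * rho q b.

(** The constant which normalizes the measure m_alpha. *)
Definition calpha : R := qpoch (tq * q ^+ 2) (q ^+ 2) n.+1.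

Lemma qpoch_gt0 (x y : R) k : 0 <= x < 1 -> 0 <= y <= 1 -> 0 < qpoch x y k.
Proof.
move=> /andP[x0 x1] /andP[y0 y1]; rewrite prodr_gt0// => j _; rewrite subr_gt0.
by apply: le_lt_trans x1; rewrite ler_piMr// exprn_ile1.
Qed.

Lemma qsq : 0 < q ^+ 2 < 1.
Proof. by rewrite exprn_gt0//= exprn_ilt1// ltW. Qed.

Lemma tqsq : 0 < tq * q ^+ 2 < 1.
Proof.
have /andP[u v] := qsq; rewrite mulr_gt0 ?tq_gt0//=.
by rewrite mulr_ilt1 ?tq_lt1// ltW// tq_gt0.
Qed.

Lemma calpha_gt0 : 0 < calpha.
Proof.
have /andP[u v] := qsq; have /andP[u' v'] := tqsq.
by apply: qpoch_gt0; rewrite ?v' ?ltW.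
Qed.

Lemma mu_gt0 b : 0 < mu b.
Proof. by have /andP[u' v'] := tqsq; rewrite mulr_gt0 ?rho_gt0// exprn_gt0. Qed.

(** The weight of the matrix unit (a, b): the quotient of norms comes from
    the adjunction, and [mu] from the measure. *)
Definition wt a b : R := locked (calpha * (hnorm2 q a / hnorm2 q b * mu b)).

Lemma wtE a b : wt a b = calpha * (hnorm2 q a / hnorm2 q b * mu b).
Proof. by rewrite /wt -lock. Qed.

Lemma wt_gt0 a b : 0 < wt a b.
Proof.
rewrite wtE; apply: mulr_gt0; first exact: calpha_gt0.
by apply: mulr_gt0; [rewrite divr_gt0// hnorm2_gt0 | exact: mu_gt0].
Qed.

Definition tdot K f g : C :=
  \sum_(a <- box K) \sum_(b <- box K) f a b * conjc (g a b) * (wt a b)%:C.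

(** Both integrals are weighted traces, and the trace of g^* f is an l^2
    product of entries. *)
Lemma dotE K f g : boxed K f -> dot q alpha f g = tdot K f g.
Proof.
move=> fK; rewrite /dot /int_m powR_tq2 -/calpha.
rewrite (int_sum q01 _ (fun k => (q `^ (2 * (k ord0)%:R * (alpha + 1)) *
  \prod_(j < n) q ^+ (2 * k (lift ord0 j)))%:C)).
rewrite (big_box (K := K)) => [|b bK]; last first.
  by rewrite (qmul_box_r _ _ _ fK) big1 ?mul0r// => c _; rewrite (boxed_r _ fK bK) mulr0.
rewrite mulr_sumr /tdot [RHS]exchange_big/=; apply: eq_bigr => b _.
rewrite (qmul_box_r _ _ _ fK) mulr_suml mulr_sumr; apply: eq_bigr => a _.
rewrite powR_tqX tailsE tail0 -/(rho q b) -/(mu b) /star wtE !rmorphM/=; ring.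
Qed.

End FiniteSums.

(** * Weighted square norms and approximation *)

Section Completion.
Variables (R : realType) (n : nat) (q : R).
Hypothesis q01 : 0 < q < 1.
Variable alpha : R.
Hypothesis alpha0 : 0 < alpha.
Local Notation C := R[i]^o.
Local Notation box := (box n).
Local Notation qop := (qop R n).
Local Notation wt := (wt q alpha).
Local Notation tdot := (tdot q alpha).
Local Notation approx := (Defs.approx q alpha).
Implicit Types (a b m d x : mi n) (f g F G H : qop) (e s : R).

Let wt0 a b : 0 < wt a b. Proof. exact: wt_gt0. Qed.

Lemma qopD f g a b : (f + g) a b = f a b + g a b. Proof. by []. Qed.
Lemma qopN f a b : (- f) a b = - f a b. Proof. by []. Qed.
Lemma qopB f g a b : (f - g) a b = f a b - g a b. Proof. by []. Qed.
Lemma qopZ (c : R[i]) f a b : (c *: f) a b = c * f a b. Proof. by []. Qed.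

Definition tnorm K f : R := \sum_(a <- box K) \sum_(b <- box K) nsq (f a b) * wt a b.

Lemma tdot_tnorm K f : tdot K f f = (tnorm K f)%:C.
Proof.
rewrite /tdot /tnorm rmorph_sum; apply: eq_bigr => a _; rewrite rmorph_sum.
by apply: eq_bigr => b _; rewrite [RHS]rmorphM /= -mul_conjc.
Qed.

Lemma tnorm_ge0 K f : 0 <= tnorm K f.
Proof. by rewrite sumr_ge0// => a _; rewrite sumr_ge0// => b _; rewrite mulr_ge0 ?nsq_ge0 ?ltW. Qed.

Lemma tnormD K f g : tnorm K (f + g) <= 2 * tnorm K f + 2 * tnorm K g.
Proof.
rewrite /tnorm !mulr_sumr -big_split; apply: ler_sum => a _.
rewrite !mulr_sumr -big_split; apply: ler_sum => b _.
by rewrite /= !mulrA -mulrDl ler_wpM2r ?(ltW (wt0 _ _))//; exact: nsqD_le.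
Qed.

Lemma tnormZ K (c : R[i]) f : tnorm K (c *: f) = nsq c * tnorm K f.
Proof.
rewrite /tnorm mulr_sumr; apply: eq_bigr => a _; rewrite mulr_sumr.
by apply: eq_bigr => b _; rewrite qopZ nsqM mulrA.
Qed.

Lemma tnormN K f : tnorm K (- f) = tnorm K f.
Proof. by apply: eq_bigr => a _; apply: eq_bigr => b _; rewrite qopN nsqN. Qed.

Lemma tnormBC K f g : tnorm K (f - g) = tnorm K (g - f).
Proof. by rewrite -tnormN opprB. Qed.

Lemma tnorm_tri K f g h : tnorm K (f - h) <= 2 * tnorm K (f - g) + 2 * tnorm K (g - h).
Proof. by rewrite -(subrKA g f (-h)) tnormD. Qed.

Lemma tnorm_entry K f a b : a \in box K -> b \in box K ->
  nsq (f a b) * wt a b <= tnorm K f.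
Proof.
move=> aK bK; rewrite /tnorm (bigD1_seq a) ?box_uniq//= (bigD1_seq b) ?box_uniq//=.
rewrite -addrA lerDl addr_ge0// sumr_ge0// => c _; last rewrite sumr_ge0// => d _.
  by rewrite mulr_ge0 ?nsq_ge0 ?ltW.
by rewrite mulr_ge0 ?nsq_ge0 ?ltW.
Qed.

Lemma big_box_mono K L (h : mi n -> R) : (K <= L)%N -> (forall m, 0 <= h m) ->
  \sum_(m <- box K) h m <= \sum_(m <- box L) h m.
Proof.
move=> KL h0; pose h' m := if m \in box K then h m else 0.
have -> : \sum_(m <- box K) h m = \sum_(m <- box L) h' m.
  rewrite (big_box_widen (K := K) KL) => [|m /negPf mK]; last by rewrite /h' mK.
  by rewrite big_seq [RHS]big_seq; apply: eq_bigr => m mK; rewrite /h' mK.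
by apply: ler_sum => m _; rewrite /h'; case: ifP.
Qed.

Lemma tnorm_mono K L f : (K <= L)%N -> tnorm K f <= tnorm L f.
Proof.
move=> KL; have w0 a b : 0 <= nsq (f a b) * wt a b by rewrite mulr_ge0 ?nsq_ge0 ?ltW.
apply: le_trans (big_box_mono KL _); last by move=> m; rewrite sumr_ge0.
by apply: ler_sum => a _; apply: big_box_mono.
Qed.

Lemma boxed_tdot K L f g : (K <= L)%N -> boxed K f -> tdot L f g = tdot K f g.
Proof. by move=> KL fK; rewrite -(dotE q01 _ _ fK) (dotE q01 _ _ (boxed_widen KL fK)). Qed.

Lemma boxed_tnorm K L f : boxed L f -> tnorm K f <= tnorm L f.
Proof.
move=> fL; apply: le_trans (tnorm_mono f (leq_maxl K L)) _.
rewrite -lecR -!tdot_tnorm (boxed_tdot _ (leq_maxr K L) fL) lexx.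
by [].
Qed.

Lemma boxedB K f g : boxed K f -> boxed K g -> boxed K (f - g).
Proof.
move=> fK gK a b; apply: contraR => ab; rewrite qopB.
have -> : f a b = 0 by apply/eqP; apply: contraNT ab; apply: fK.
by have -> : g a b = 0; [apply/eqP; apply: contraNT ab; apply: gK | rewrite subrr].
Qed.

Lemma boxedD K f g : boxed K f -> boxed K g -> boxed K (f + g).
Proof.
move=> fK gK; rewrite -[g]opprK; apply: boxedB => // a b.
by rewrite qopN oppr_eq0; apply: gK.
Qed.

Lemma boxedZ K (c : R[i]) f : boxed K f -> boxed K (c *: f).
Proof. by move=> fK a b; rewrite qopZ mulf_eq0 negb_or => /andP[_]; apply: fK. Qed.

Lemma tdotC K f g : tdot K g f = conjc (tdot K f g).
Proof.
rewrite /tdot [RHS](raddf_sum (@conjc R)); apply: eq_bigr => a _.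
rewrite [RHS](raddf_sum (@conjc R)); apply: eq_bigr => b _.
by rewrite /= !conjcM conjcK conjc_real [g a b * _]mulrC.
Qed.

Lemma tdotDl K f g h : tdot K (f + g) h = tdot K f h + tdot K g h.
Proof.
rewrite /tdot -big_split; apply: eq_bigr => a _; rewrite -big_split.
by apply: eq_bigr => b _ /=; rewrite qopD !mulrDl.
Qed.

Lemma tdotZl K (c : R[i]) f h : tdot K (c *: f) h = c * tdot K f h.
Proof.
rewrite /tdot mulr_sumr; apply: eq_bigr => a _; rewrite mulr_sumr.
by apply: eq_bigr => b _ /=; rewrite qopZ !mulrA.
Qed.

Lemma tdotBl K f g h : tdot K (f - g) h = tdot K f h - tdot K g h.
Proof. by rewrite -scaleN1r tdotDl tdotZl mulN1r. Qed.

Lemma tdotBr K f g h : tdot K f (g - h) = tdot K f g - tdot K f h.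
Proof. by rewrite tdotC tdotBl conjcB -!tdotC. Qed.

Lemma tdot_young K f g s : 0 < s -> normc (tdot K f g) <= s * tnorm K f + tnorm K g / s.
Proof.
move=> s0; have normc_sum (r : seq (mi n)) (h : mi n -> R[i]) :
    normc (\sum_(i <- r) h i) <= \sum_(i <- r) normc (h i).
  elim: r => [|i r IH]; first by rewrite !big_nil normc0.
  by rewrite !big_cons; apply: le_trans (normcD_le _ _) _; rewrite lerD2l.
rewrite /tnorm mulr_sumr mulr_suml -big_split; apply: le_trans (normc_sum _ _) _.
apply: ler_sum => a _; rewrite mulr_sumr mulr_suml -big_split; apply: le_trans (normc_sum _ _) _.
apply: ler_sum => b _ /=; rewrite normcM normc_real (ger0_norm (ltW (wt0 a b))).
by rewrite mulrA [_ * wt a b / s]mulrAC -mulrDl ler_wpM2r ?(ltW (wt0 _ _))//; exact: young.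
Qed.

(** The uniform continuity of the truncated forms on bounded sets, with a
    modulus independent of the truncation. *)
Lemma tdot_small M e : 0 < e -> exists2 d, 0 < d & forall K f g,
  tnorm K f <= d -> tnorm K g <= M ->
  normc (tdot K f g) <= e /\ normc (tdot K g f) <= e.
Proof.
move=> e0; pose M' := `|M| + 1; have M0 : 0 < M' by rewrite ltr_wpDl.
(* This s makes the second term of tdot_young at most e / 2. *)
pose s := M' / (e / 2); have s0 : 0 < s by rewrite !divr_gt0.
exists (e / 2 / s) => [|K f g fd gM]; first by rewrite !divr_gt0.
have H : normc (tdot K f g) <= e; last by rewrite [tdot K g f]tdotC normc_conj.
apply: le_trans (tdot_young K f g s0) _; rewrite [e]splitr lerD//.
  by rewrite mulrC -ler_pdivlMr.
rewrite ler_pdivrMr// /s mulrC divfK ?gt_eqF ?divr_gt0//.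
by apply: le_trans gM _; apply: le_trans (ler_norm _) _; rewrite lerDl.
Qed.

(** Convergence in norm to an arbitrary matrix F, expressed by bounds uniform
    in the truncation, so that no infinite sum has to be formed. *)
Definition tends (u : nat -> qop) F := forall e, 0 < e -> exists k0,
  forall k, (k0 <= k)%N -> forall K, tnorm K (u k - F) <= e.

Lemma eventually_sum (T : Type) (r : seq T) (h : nat -> T -> R) :
  (forall (i : T) e, 0 < e -> exists k0, forall k, (k0 <= k)%N -> h k i <= e) ->
  forall e, 0 < e -> exists k0, forall k, (k0 <= k)%N -> \sum_(i <- r) h k i <= e.
Proof.
move=> hx; elim: r => [|x r IH] e e0.
  by exists 0%N => k _; rewrite big_nil ltW.
have e20 : 0 < e / 2 by rewrite divr_gt0.
have [k1 k1P] := hx x _ e20; have [k2 k2P] := IH _ e20.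
exists (maxn k1 k2) => k; rewrite geq_max => /andP[/k1P ? /k2P ?].
by rewrite big_cons [e]splitr lerD.
Qed.

Lemma tnorm_pointwise (u : nat -> qop) F K e :
  (forall a b, (fun k => u k a b) @ \oo --> F a b) -> 0 < e ->
  exists k0, forall k, (k0 <= k)%N -> tnorm K (u k - F) <= e.
Proof.
move=> uF; move: e; apply: eventually_sum => a; apply: eventually_sum => b e e0.
(* If r < min 1 (e / w) then r^2 w <= r w <= e. *)
have d0 : 0 < Num.min 1 (e / wt a b) by rewrite lt_min ltr01 divr_gt0.
have /cvgC/(_ _ d0)[k0 k0P] := uF a b; exists k0 => k /k0P.
rewrite lt_min => /andP[d1 de]; rewrite -ler_pdivlMr// nsqE qopB.
apply: le_trans (ltW de); rewrite expr2 ler_piMl ?normc_ge0// ltW//.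
Qed.

(** Fatou's lemma: the square norm of u_k - u_l over a box is small for all
    large l, and letting l tend to infinity in that finite sum bounds the norm of
    u_k - F over the box, independently of the box. *)
Lemma approxP (u : nat -> qop) F :
  approx u F <-> (forall k, finite_op (u k)) /\ tends u F.
Proof.
split=> [[fin cau pw]|[fin tu]].
  split=> // e e0; have e40 : 0 < e / 4 by rewrite divr_gt0.
  have e40' : 0 < (e / 4)%:C :> R[i] by rewrite ltcR.
  have [k0 k0P] := cau _ e40'; exists k0 => k kk K.
  have [k1 k1P] := tnorm_pointwise K pw e40.
  pose l := maxn k0 k1; have := k1P l (leq_maxr _ _).
  have /finite_opP[K1 u1] := fin k; have /finite_opP[K2 u2] := fin l.
  have uB := boxedB (boxed_widen (leq_maxl K1 K2) u1) (boxed_widen (leq_maxr K1 K2) u2).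
  have := k0P k l kk (leq_maxl _ _); rewrite (dotE q01 _ _ uB) tdot_tnorm ltcR => h1 h2.
  apply: le_trans (tnorm_tri K (u k) (u l) F) _.
  have := boxed_tnorm K uB; lra.
split=> // [e /posC[d d0 ->]|a b].
  have d80 : 0 < d / 8 by rewrite divr_gt0.
  have [k0 k0P] := tu _ d80; exists k0 => k l kk ll.
  have /finite_opP[K1 u1] := fin k; have /finite_opP[K2 u2] := fin l.
  have uB := boxedB (boxed_widen (leq_maxl K1 K2) u1) (boxed_widen (leq_maxr K1 K2) u2).
  rewrite (dotE q01 _ _ uB) tdot_tnorm ltcR; set K := maxn K1 K2.
  have := tnorm_tri K (u k) F (u l); rewrite (tnormBC K F).
  by have := k0P k kk K; have := k0P l ll K; lra.
apply/cvgC => e e0.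
have e0' : 0 < (e / 2) ^+ 2 * wt a b by rewrite mulr_gt0// exprn_gt0// divr_gt0.
have [k0 k0P] := tu _ e0'; exists k0 => k kk.
have aK : a \in box (maxn (mdeg a) (mdeg b)).+1 by apply: mdeg_box; rewrite ltnS leq_maxl.
have bK : b \in box (maxn (mdeg a) (mdeg b)).+1 by apply: mdeg_box; rewrite ltnS leq_maxr.
have := le_trans (tnorm_entry (u k - F) aK bK) (k0P k kk _).
have e2 : 0 <= e / 2 by rewrite divr_ge0// ltW.
rewrite ler_pM2r// qopB nsqE ler_pXn2r ?nnegrE ?normc_ge0// => h.
by apply: le_lt_trans h _; rewrite ltr_pdivrMr// ltr_pMr// ltr1n.
Qed.

End Completion.

(** * The scalar product on the completion *)

Section CompletedForm.
Variables (R : realType) (n : nat) (q : R).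
Hypothesis q01 : 0 < q < 1.
Variable alpha : R.
Hypothesis alpha0 : 0 < alpha.
Local Notation C := R[i]^o.
Local Notation box := (box n).
Local Notation qop := (qop R n).
Local Notation wt := (wt q alpha).
Local Notation tdot := (tdot q alpha).
Local Notation tnorm := (tnorm q alpha).
Local Notation tends := (tends q alpha).
Local Notation dot := (Defs.dot q alpha).
Local Notation dotL2 := (Defs.dotL2 q alpha).
Local Notation L2 := (Defs.L2 q alpha).
Local Notation approx := (Defs.approx q alpha).
Implicit Types (a b m d x : mi n) (f g F G H : qop) (e s : R).
Let approxP := @approxP R n q q01 alpha alpha0.
Let dotE := @dotE R n q q01 alpha.

Lemma tends_bound (u : nat -> qop) F : (forall k, finite_op (u k)) -> tends u F ->
  exists M, forall K, tnorm K F <= M.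
Proof.
move=> fin /(_ 1 ltr01)[k0 k0P]; have /finite_opP[L uL] := fin k0.
exists (2 * tnorm L (u k0) + 2) => K; rewrite -[F]subr0.
apply: le_trans (tnorm_tri q01 alpha0 K F (u k0) 0) _; rewrite subr0 tnormBC.
have := k0P k0 (leqnn _) K; have := boxed_tnorm q01 alpha0 K uL; lra.
Qed.

(** Two pairs of approximating sequences have asymptotically equal scalar
    products.  With u = u' and v = v' this is the Cauchy property, and in general
    it shows that the limit does not depend on the sequences. *)
Lemma dot_close (u u' v v' : nat -> qop) F G e :
  approx u F -> approx u' F -> approx v G -> approx v' G -> 0 < e ->
  exists k0, forall k l, (k0 <= k)%N -> (k0 <= l)%N ->
    normc (dot (u k) (v k) - dot (u' l) (v' l)) < e.
Proof.
move=> /approxP[fu tu] /approxP[fu' tu'] /approxP[fv tv] /approxP[fv' tv'] e0.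
have [MF hF] := tends_bound fu tu; have [MG hG] := tends_bound fv tv.
have e40 : 0 < e / 4 by rewrite divr_gt0.
have [d1 d10 s1] := tdot_small n q01 alpha0 (2 * MG + 2) e40.
have [d2 d20 s2] := tdot_small n q01 alpha0 (2 * MF + 2) e40.
(* Being within 1 of the limit keeps the sequences bounded; being within d1 / 4
   and d2 / 4 makes the differences small. *)
pose d := Num.min 1 (Num.min (d1 / 4) (d2 / 4)).
have d0 : 0 < d by rewrite !lt_min ltr01 !divr_gt0.
have dP : [/\ d <= 1, d <= d1 / 4 & d <= d2 / 4].
  by rewrite /d !ge_min !lexx !orbT.
have [k1 k1P] := tu _ d0; have [k2 k2P] := tu' _ d0.
have [k3 k3P] := tv _ d0; have [k4 k4P] := tv' _ d0.
exists (maxn (maxn k1 k2) (maxn k3 k4)) => k l; rewrite !geq_max.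
move=> /andP[/andP[kk1 kk2] /andP[kk3 kk4]] /andP[/andP[l1 l2] /andP[l3 l4]].
have /finite_opP[K1 b1] := fu k; have /finite_opP[K2 b2] := fu' l.
pose K := maxn K1 K2.
rewrite (dotE _ (boxed_widen (leq_maxl K1 K2) b1)) (dotE _ (boxed_widen (leq_maxr K1 K2) b2)) -/K.
have -> : tdot K (u k) (v k) - tdot K (u' l) (v' l) =
    tdot K (u k - u' l) (v k) + tdot K (u' l) (v k - v' l).
  by rewrite tdotBl tdotBr; ring.
case: dP => dd1 dd2 dd3.
have [] := s1 K (u k - u' l) (v k) _ _.
- have := tnorm_tri q01 alpha0 K (u k) F (u' l); rewrite (tnormBC _ _ _ F).
  by have := k1P k kk1 K; have := k2P l l2 K; lra.
- have := tnorm_tri q01 alpha0 K (v k) G 0; rewrite !subr0.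
  by have := k3P k kk3 K; have := hG K; lra.
move=> h1 _.
have [] := s2 K (v k - v' l) (u' l) _ _.
- have := tnorm_tri q01 alpha0 K (v k) G (v' l); rewrite (tnormBC _ _ _ G).
  by have := k3P k kk3 K; have := k4P l l4 K; lra.
- have := tnorm_tri q01 alpha0 K (u' l) F 0; rewrite !subr0.
  by have := k2P l l2 K; have := hF K; lra.
move=> _ h2; apply: le_lt_trans (normcD_le _ _) _; lra.
Qed.

Lemma dotL2_cvg (u v : nat -> qop) F G : approx u F -> approx v G ->
  (fun k => dot (u k) (v k) : C) @ \oo --> dotL2 F G.
Proof.
move=> uF vG; rewrite /Defs.dotL2; case: xgetP => [l _ [u' [v' [uF' vG' /cvgC ul]]]|no].
  apply/cvgC => e e0; have e20 : 0 < e / 2 by rewrite divr_gt0.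
  have [k1 k1P] := dot_close uF uF' vG vG' e20; have [k2 k2P] := ul _ e20.
  exists (maxn k1 k2) => k; rewrite geq_max => /andP[kk1 kk2].
  have -> : dot (u k) (v k) - l = (dot (u k) (v k) - dot (u' k) (v' k)) + (dot (u' k) (v' k) - l).
    by rewrite subrKA.
  apply: le_lt_trans (normcD_le _ _) _; rewrite [e]splitr.
  by apply: ltrD; [exact: k1P|exact: k2P].
have [l ul] : exists l : C, (fun k => dot (u k) (v k) : C) @ \oo --> l.
  by apply: cauchyC => e e0; exact: (dot_close uF uF vG vG e0).
by case: (no l); exists u, v.
Qed.

Lemma dotL2_lim (u v : nat -> qop) F G (l : C) : approx u F -> approx v G ->
  (fun k => dot (u k) (v k) : C) @ \oo --> l -> dotL2 F G = l.
Proof. by move=> uF vG; apply: cvgC_unique; apply: dotL2_cvg. Qed.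

Lemma approxD (u v : nat -> qop) F G : approx u F -> approx v G ->
  approx (fun k => u k + v k) (F + G).
Proof.
move=> /approxP[fu tu] /approxP[fv tv]; apply/approxP; split=> [k|e e0].
  have /finite_opP[K1 b1] := fu k; have /finite_opP[K2 b2] := fv k.
  apply/finite_opP; exists (maxn K1 K2); apply: boxedD.
    exact: boxed_widen (leq_maxl K1 K2) b1.
  exact: boxed_widen (leq_maxr K1 K2) b2.
have e40 : 0 < e / 4 by rewrite divr_gt0.
have [k1 k1P] := tu _ e40; have [k2 k2P] := tv _ e40.
exists (maxn k1 k2) => k; rewrite geq_max => /andP[kk1 kk2] K.
rewrite opprD addrACA; apply: le_trans (tnormD q01 alpha0 _ _ _) _.
by have := k1P k kk1 K; have := k2P k kk2 K; lra.
Qed.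

Lemma approxZ (u : nat -> qop) F (c : R[i]) : approx u F -> approx (fun k => c *: u k) (c *: F).
Proof.
move=> /approxP[fu tu]; apply/approxP; split=> [k|e e0].
  by have /finite_opP[K b] := fu k; apply/finite_opP; exists K; exact: boxedZ.
have c0 : 0 < nsq c + 1 by rewrite ltr_wpDl// nsq_ge0.
have e0' : 0 < e / (nsq c + 1) by rewrite divr_gt0.
have [k0 k0P] := tu _ e0'; exists k0 => k kk K.
rewrite -scalerBr tnormZ; have := k0P k kk K; rewrite ler_pdivlMr//.
have := tnorm_ge0 q01 alpha0 K (u k - F); have := nsq_ge0 c; nra.
Qed.

Lemma approx_cst f : finite_op f -> approx (fun=> f) f.
Proof.
move=> ff; apply/approxP; split=> // e e0; exists 0%N => k _ K.
rewrite subrr /tnorm big1 ?ltW// => a _; rewrite big1// => b _.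
by rewrite [X in nsq X](_ : _ = 0)// nsq0 mul0r.
Qed.

Lemma L2_finite f : finite_op f -> L2 f.
Proof. by move=> ff; exists (fun=> f); exact: approx_cst. Qed.

Lemma L2D F G : L2 F -> L2 G -> L2 (F + G).
Proof. by move=> [u uF] [v vG]; exists (fun k => u k + v k); exact: approxD. Qed.

Lemma L2Z (c : R[i]) F : L2 F -> L2 (c *: F).
Proof. by move=> [u uF]; exists (fun k => c *: u k); exact: approxZ. Qed.

Lemma L2N F : L2 F -> L2 (- F).
Proof. by move=> LF; rewrite -scaleN1r; exact: (L2Z (-1) LF). Qed.

Lemma L2B F G : L2 F -> L2 G -> L2 (F - G).
Proof. by move=> LF LG; exact: (L2D LF (L2N LG)). Qed.

Lemma dotDl f g h : finite_op f -> finite_op g -> dot (f + g) h = dot f h + dot g h.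
Proof.
move=> /finite_opP[K1 b1] /finite_opP[K2 b2].
have {}b1 := boxed_widen (leq_maxl K1 K2) b1.
have {}b2 := boxed_widen (leq_maxr K1 K2) b2.
by rewrite (dotE _ b1) (dotE _ b2) (dotE _ (boxedD b1 b2)) tdotDl.
Qed.

Lemma dotZl (c : R[i]) f h : finite_op f -> dot (c *: f) h = c * dot f h.
Proof.
by move=> /finite_opP[K b]; rewrite (dotE _ b) (dotE _ (boxedZ (c := c) b)) tdotZl.
Qed.

Lemma dotC f g : finite_op f -> finite_op g -> dot g f = conjc (dot f g).
Proof.
move=> /finite_opP[K1 b1] /finite_opP[K2 b2].
have {}b1 := boxed_widen (leq_maxl K1 K2) b1.
have {}b2 := boxed_widen (leq_maxr K1 K2) b2.
by rewrite (dotE _ b1) (dotE _ b2) tdotC.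
Qed.

Lemma dotL2Dl F G H : L2 F -> L2 G -> L2 H -> dotL2 (F + G) H = dotL2 F H + dotL2 G H.
Proof.
move=> [u uF] [v vG] [w wH]; apply: (dotL2_lim (approxD uF vG) wH).
rewrite (_ : (fun k => _) = (fun k => dot (u k) (w k) : C) \+ (fun k => dot (v k) (w k) : C)).
  by apply: cvgD; apply: dotL2_cvg.
by apply/funext => k /=; rewrite dotDl//; [case: uF|case: vG].
Qed.

Lemma dotL2Zl (c : R[i]) F H : L2 F -> L2 H -> dotL2 (c *: F) H = c * dotL2 F H.
Proof.
move=> [u uF] [w wH]; apply: (dotL2_lim (approxZ c uF) wH).
have /cvgC uw := dotL2_cvg uF wH; apply/cvgC => e e0.
have c0 : 0 < normc c + 1 by rewrite ltr_wpDl// normc_ge0.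
have e0' : 0 < e / (normc c + 1) by rewrite divr_gt0.
have [k0 k0P] := uw _ e0'; exists k0 => k kk.
rewrite dotZl; last by case: uF.
rewrite -mulrBr normcM; have := k0P k kk; rewrite ltr_pdivlMr//.
have := normc_ge0 (dot (u k) (w k) - dotL2 F H); have := normc_ge0 c; nra.
Qed.

Lemma dotL2C F G : L2 F -> L2 G -> dotL2 G F = conjc (dotL2 F G).
Proof.
move=> [u uF] [v vG]; apply: (dotL2_lim vG uF).
have /cvgC uv := dotL2_cvg uF vG; apply/cvgC => e /uv[k0 k0P]; exists k0 => k kk.
rewrite dotC; [|by case: uF|by case: vG].
by rewrite -conjcB normc_conj k0P.
Qed.

Lemma dotL2Nl F H : L2 F -> L2 H -> dotL2 (- F) H = - dotL2 F H.
Proof. by move=> LF LH; rewrite -scaleN1r (dotL2Zl (-1) LF LH) mulN1r. Qed.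

Lemma dotL2Bl F G H : L2 F -> L2 G -> L2 H -> dotL2 (F - G) H = dotL2 F H - dotL2 G H.
Proof. by move=> LF LG LH; rewrite (dotL2Dl LF (L2N LG) LH) (dotL2Nl LG LH). Qed.

Lemma dotL2Dr F G H : L2 F -> L2 G -> L2 H -> dotL2 H (F + G) = dotL2 H F + dotL2 H G.
Proof.
move=> LF LG LH; rewrite (dotL2C (L2D LF LG) LH) (dotL2Dl LF LG LH) (dotL2C LF LH) (dotL2C LG LH).
exact: (raddfD (@conjc R)).
Qed.

Lemma dotL2Br F G H : L2 F -> L2 G -> L2 H -> dotL2 H (F - G) = dotL2 H F - dotL2 H G.
Proof.
move=> LF LG LH; rewrite (dotL2C (L2B LF LG) LH) (dotL2Bl LF LG LH).
by rewrite (dotL2C LF LH) (dotL2C LG LH) conjcB.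
Qed.

Definition nrm2 F : R := complex.Re (dotL2 F F).

Lemma ltr_dist_split (x y e : R) : `|x - y| < e -> x <= y + e /\ y <= x + e.
Proof. rewrite ltr_norml => /andP[h1 h2]; split; lra. Qed.

(** Elements of the completion are replaced by finite functions, so that
    inequalities between finite sums pass to the limit. *)
Lemma dotL2_sample F G e : L2 F -> L2 G -> 0 < e -> exists K f g,
  [/\ normc (dotL2 F G - tdot K f g) <= e,
      tnorm K f <= nrm2 F + e, tnorm K g <= nrm2 G + e,
      nrm2 F <= tnorm K f + e & forall L, tnorm L F <= 2 * (nrm2 F + e) + e].
Proof.
move=> [u uF] [v vG] e0; have e20 : 0 < e / 2 by rewrite divr_gt0.
have /cvgC/(_ _ e0)[k1 k1P] := dotL2_cvg uF vG.
have /cvgC/(_ _ e0)[k2 k2P] := dotL2_cvg uF uF.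
have /cvgC/(_ _ e0)[k3 k3P] := dotL2_cvg vG vG.
have /approxP[fu tu] := uF; have /approxP[fv tv] := vG.
have [k4 k4P] := tu _ e20.
pose k := maxn (maxn k1 k2) (maxn k3 k4).
have [kk1 kk2 kk3 kk4] : [/\ k1 <= k, k2 <= k, k3 <= k & k4 <= k]%N.
  by rewrite !leq_max !leqnn !orbT.
have /finite_opP[K1 b1] := fu k; have /finite_opP[K2 b2] := fv k.
have {}b1 := boxed_widen (leq_maxl K1 K2) b1.
have {}b2 := boxed_widen (leq_maxr K1 K2) b2.
exists (maxn K1 K2), (u k), (v k); move: b1 b2; set K := maxn K1 K2 => b1 b2.
have h2 := k2P k kk2; have h3 := k3P k kk3.
rewrite (dotE _ b1) (tdot_tnorm q alpha) in h2; rewrite (dotE _ b2) (tdot_tnorm q alpha) in h3.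
have {}h2 := le_lt_trans (normc_Re _) h2; have {}h3 := le_lt_trans (normc_Re _) h3.
rewrite raddfB /= -/(nrm2 F) in h2; rewrite raddfB /= -/(nrm2 G) in h3.
have [h2a h2b] := ltr_dist_split h2; have [h3a h3b] := ltr_dist_split h3.
split=> // [|L]; first by rewrite -normc_opp opprB -(dotE _ b1) ltW// k1P.
have := tnorm_tri q01 alpha0 L F (u k) 0; rewrite !subr0 (tnormBC _ _ _ F).
have := k4P k kk4 L; have := boxed_tnorm q01 alpha0 L b1; move: h2a.
move: (tnorm L _) (tnorm L _) (tnorm L _) (tnorm K _) (nrm2 F).
clear - e; move=> x1 x2 x3 x4 x5; lra.
Qed.

Lemma dotL2_nrm2 F : L2 F -> dotL2 F F = (nrm2 F)%:C.
Proof.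
move=> LF; have := dotL2C LF LF; rewrite /nrm2; case: (dotL2 F F) => x y /= [] /eqP.
by rewrite -subr_eq0 opprK -mulr2n mulrn_eq0/= => /eqP->.
Qed.

Lemma nrm2_ge0 F : L2 F -> 0 <= nrm2 F.
Proof.
move=> LF; apply/ler_addgt0Pr => e e0.
have [K [f [g [_ h _ _ _]]]] := dotL2_sample LF LF e0.
by apply: le_trans h; exact: tnorm_ge0.
Qed.

Lemma nrm2_eq0 F : L2 F -> nrm2 F <= 0 -> F = 0.
Proof.
move=> LF F0; apply/funext => a; apply/funext => b.
pose L := (maxn (mdeg a) (mdeg b)).+1.
have aL : a \in box L by apply: mdeg_box; rewrite ltnS leq_maxl.
have bL : b \in box L by apply: mdeg_box; rewrite ltnS leq_maxr.
have : nsq (F a b) * wt a b <= 0.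
  apply/ler_addgt0Pr => e e0; have e30 : 0 < e / 3 by rewrite divr_gt0.
  have [K [f [g [_ _ _ _ h]]]] := dotL2_sample LF LF e30.
  apply: le_trans (tnorm_entry q01 alpha0 F aL bL) _; have := h L; lra.
rewrite pmulr_lle0 ?wt_gt0// => h; apply: nsq_eq0; apply/eqP.
by rewrite eq_le h nsq_ge0.
Qed.

Lemma Re_parallelogram (x y z w : R[i]) : 0 <= complex.Re (x + y + (z + w)) ->
  complex.Re (x - y - (z - w)) <= 2 * complex.Re x + 2 * complex.Re w.
Proof. case: x y z w => [? ?] [? ?] [? ?] [? ?] /=; lra. Qed.

(** From the parallelogram identity, dropping the nonnegative norm of F + G. *)
Lemma nrm2B_le F G : L2 F -> L2 G -> nrm2 (F - G) <= 2 * nrm2 F + 2 * nrm2 G.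
Proof.
move=> LF LG; have := nrm2_ge0 (L2D LF LG); rewrite /nrm2.
rewrite (dotL2Dl LF LG (L2D LF LG)) (dotL2Dr LF LG LF) (dotL2Dr LF LG LG).
rewrite (dotL2Bl LF LG (L2B LF LG)) (dotL2Br LF LG LF) (dotL2Br LF LG LG).
exact: Re_parallelogram.
Qed.

Lemma young_perturb (s d x1 x2 y1 y2 u v w : R) : 0 < s ->
  u <= w + v -> w <= d -> v <= s * y1 + y2 / s -> y1 <= x1 + d -> y2 <= x2 + d ->
  u <= s * x1 + x2 / s + d * (s + s^-1 + 1).
Proof.
move=> s0; have : 0 < s^-1 by rewrite invr_gt0.
by move: s^-1 => t t0; nra.
Qed.

Lemma dotL2_young F G s : L2 F -> L2 G -> 0 < s ->
  normc (dotL2 F G) <= s * nrm2 F + nrm2 G / s.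
Proof.
move=> LF LG s0; apply/ler_addgt0Pr => e e0.
have si0 : 0 < s^-1 by rewrite invr_gt0.
have c0 : 0 < s + s^-1 + 1 by rewrite !addr_gt0.
have e0' : 0 < e / (s + s^-1 + 1) by rewrite divr_gt0.
have [K [f [g [h1 h2 h3 _ _]]]] := dotL2_sample LF LG e0'.
set d := e / _ in h1 h2 h3 e0'; have de : e = d * (s + s^-1 + 1) by rewrite divfK ?gt_eqF.
have hA : normc (dotL2 F G) <= normc (dotL2 F G - tdot K f g) + normc (tdot K f g).
  by rewrite -{1}[dotL2 F G](subrK (tdot K f g)) normcD_le.
rewrite de; exact: (young_perturb s0 hA h1 (tdot_young q01 alpha0 K f g s0) h2 h3).
Qed.

End CompletedForm.

(** * The q-binomial series *)

Section QBinomialSeries.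
Variable R : realType.
Implicit Types (p x : R).

Lemma qpochS x p m : qpoch x p m.+1 = qpoch x p m * (1 - x * p ^+ m).
Proof. by rewrite /qpoch big_ord_recr. Qed.

Lemma qpoch0 x p : qpoch x p 0 = 1.
Proof. by rewrite /qpoch big_ord0. Qed.

Lemma qpochD x p m k : qpoch x p (m + k) = qpoch x p m * qpoch (x * p ^+ m) p k.
Proof.
elim: k => [|k IH]; first by rewrite addn0 qpoch0 mulr1.
by rewrite addnS !qpochS IH exprD !mulrA.
Qed.

Lemma qpoch1 x p : qpoch x p 1 = 1 - x.
Proof. by rewrite qpochS qpoch0 mul1r expr0 mulr1. Qed.

(** Since (p;p)_(m+1+i) = (p;p)_(m+i) (1 - p^(m+1) p^i), the series for m+1 at
    x is the series for m at x minus p^(m+1) times the series for m at p x. *)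
Lemma qbinomial_series p x m : 0 < p < 1 -> 0 <= x < 1 ->
  (fun K => \sum_(i < K) qpoch p p (m + i) / qpoch p p i * x ^+ i) @ \oo -->
    qpoch p p m / qpoch x p m.+1.
Proof.
move=> /andP[p0 p1]; have p01 : 0 <= p <= 1 by rewrite !ltW.
elim: m x => [|m IH] x /andP[x0 x1].
  rewrite qpoch0 qpoch1.
  rewrite (_ : (fun K => _) = series (geometric 1 x)).
    by apply: cvg_geometric_series; rewrite ger0_norm.
  apply/funext => K; rewrite seriesEord; apply: eq_bigr => i _.
  have h : 0 < qpoch p p i by rewrite qpoch_gt0// (ltW p0).
  by rewrite /= divff// gt_eqF.
have px : 0 <= p * x < 1 by rewrite mulr_ge0 ?(ltW p0)//= mulr_ilt1// ltW.
have Q0 : 0 < qpoch x p m.+1 by rewrite qpoch_gt0// x0.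
have Q1 : 0 < qpoch (p * x) p m.+1 by rewrite qpoch_gt0.
have Qe : qpoch x p m.+1 * (1 - x * p ^+ m.+1) = (1 - x) * qpoch (p * x) p m.+1.
  by rewrite -qpochS -[m.+2]add1n qpochD qpoch1 expr1 [x * p]mulrC.
have x1' : 0 < 1 - x by rewrite subr_gt0.
have x2' : 0 < 1 - x * p ^+ m.+1.
  by rewrite subr_gt0 mulr_ilt1// ?exprn_ge0 ?exprn_ilt1 ?ltW.
have -> : qpoch p p m.+1 / qpoch x p m.+2 = qpoch p p m / qpoch x p m.+1 -
    p ^+ m.+1 * (qpoch p p m / qpoch (p * x) p m.+1).
  rewrite [qpoch x p m.+2]qpochS [qpoch p p m.+1]qpochS -exprS.
  have -> : qpoch (p * x) p m.+1 = qpoch x p m.+1 * (1 - x * p ^+ m.+1) / (1 - x).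
    by rewrite Qe mulrAC divff ?mul1r// gt_eqF.
  by field; rewrite !gt_eqF.
rewrite (_ : (fun K => _) = (fun K => \sum_(i < K) qpoch p p (m + i) / qpoch p p i * x ^+ i) -
    (fun K => p ^+ m.+1 * \sum_(i < K) qpoch p p (m + i) / qpoch p p i * (p * x) ^+ i)).
  apply: cvgB; first by apply: IH; rewrite x0.
  by apply: cvgM; [exact: cvg_cst | exact: IH].
apply/funext => K; rewrite /= !fctE mulr_sumr -sumrB; apply: eq_bigr => i _.
rewrite addSn qpochS -exprS exprMn -addSn exprD; ring.
Qed.

Lemma cvg_prod_seq (T : Type) (r : seq T) (u : T -> nat -> R) (l : T -> R) :
  (forall i, u i @ \oo --> l i) ->
  (fun K => \prod_(i <- r) u i K) @ \oo --> \prod_(i <- r) l i.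
Proof.
move=> ul; elim: r => [|i r IH].
  rewrite big_nil (_ : (fun K => _) = cst 1); first exact: cvg_cst.
  by apply/funext => K; rewrite big_nil.
rewrite big_cons (_ : (fun K => _) = u i \* (fun K => \prod_(i <- r) u i K)).
  exact: cvgM.
by apply/funext => K; rewrite big_cons.
Qed.

End QBinomialSeries.

(** * Norms of the monomials *)

Section MonomialNorms.
Variables (R : realType) (n : nat) (q : R).
Hypothesis q01 : 0 < q < 1.
Variable alpha : R.
Hypothesis alpha0 : 0 < alpha.
Local Notation C := R[i]^o.
Local Notation box := (box n).
Local Notation qop := (qop R n).
Local Notation wt := (wt q alpha).
Local Notation mu := (mu q alpha).
Local Notation tdot := (tdot q alpha).
Local Notation tnorm := (tnorm q alpha).
Local Notation dot := (Defs.dot q alpha).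
Local Notation dotL2 := (Defs.dotL2 q alpha).
Local Notation L2 := (Defs.L2 q alpha).
Local Notation approx := (Defs.approx q alpha).
Local Notation p := (q ^+ 2).
Local Notation tp := (tq q alpha * q ^+ 2).
Implicit Types (a b m d x : mi n) (f g F G H : qop) (e s : R).
Let approxP := @approxP R n q q01 alpha alpha0.
Let dotE := @dotE R n q q01 alpha.
Let q0 : 0 < q. Proof. by case/andP: q01. Qed.

Lemma box_prod K (h : 'I_n.+1 -> nat -> R) :
  \sum_(b <- box K) \prod_j h j (b j) = \prod_j \sum_(i < K) h j i.
Proof.
rewrite big_map big_enum/= bigA_distr_bigA/=; apply: eq_bigr => f _.
by apply: eq_bigr => j _; rewrite ffunE.
Qed.

(** The contribution of the column b to the squared norm of z^m. *)
Definition zweight m b : R := (q ^+ cross m b) ^+ 2 * wt (m + b) b.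

Lemma zweight_ge0 m b : 0 <= zweight m b.
Proof. by rewrite mulr_ge0 ?sqr_ge0// ltW// wt_gt0. Qed.

Definition ztrunc_norm m K : R := \sum_(b <- box K) zweight m b.

(** The squared norm of z^m. *)
Definition znorm m : R := hnorm2 q m / qpoch (tp * p ^+ n.+1) p (mdeg m).

(** After exchanging the double sum in [cross m b], every factor of the weight
    splits into contributions of the single components b_j. *)
Lemma zweight_prod m b : zweight m b = calpha n q alpha * \prod_(j < n.+1)
  (qpoch p p (m j + b j) / qpoch p p (b j) * (tp * p ^+ (j + mhead m j)) ^+ b j).
Proof.
rewrite /zweight wtE mulrCA; congr (_ * _).
rewrite [RHS]big_split /= prodf_div mulrCA; congr (_ / _ * _).
  by apply: eq_bigr => j _; rewrite maddE.
rewrite /mu (rhoE q01) /mdeg (big_morph (fun k => tp ^+ k) (exprD _) (expr0 _)).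
rewrite -exprM mulnC cross_mhead big_distrr/= (big_morph (fun k => q ^+ k) (exprD _) (expr0 _)).
rewrite mulrCA -!big_split; apply: eq_bigr => j _ /=.
rewrite [RHS]exprMn; congr (_ * _); rewrite -!exprM -exprD; congr (_ ^+ _); lia.
Qed.

(** The j-th block covers the exponents from j + m_0 + ... + m_(j-1) on and has
    length m_j + 1, so the next block starts where it ends. *)
Lemma qpoch_consecutive m : \prod_(j < n.+1) qpoch (tp * p ^+ (j + mhead m j)) p (m j).+1 =
  qpoch tp p (n.+1 + mdeg m).
Proof.
have H J : (J <= n.+1)%N ->
    \prod_(j < n.+1 | (j < J)%N) qpoch (tp * p ^+ (j + mhead m j)) p (m j).+1 =
    qpoch tp p (J + mhead m J).
  elim: J => [|J IH] JN.
    by rewrite big_pred0// /mhead big_pred0// qpoch0.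
  rewrite (bigD1 (Ordinal JN))//= (_ : \prod_(j < _ | _) _ = qpoch tp p (J + mhead m J)).
    rewrite mulrC -qpochD (mheadS m (Ordinal JN)) /=; congr qpoch; lia.
  rewrite -IH; last exact: ltnW.
  by apply: eq_bigl => j; rewrite -val_eqE/=; lia.
rewrite -mhead_max -H//; apply: eq_bigl => j.
by rewrite ltn_ord.
Qed.

Lemma ztrunc_norm_cvg m : ztrunc_norm m @ \oo --> znorm m.
Proof.
have /andP[tp0 tp1] := tqsq q01 alpha0; have /andP[p0 p1] := qsq q01.
have p01 : 0 <= p <= 1 by rewrite !ltW.
have xj (k : nat) : 0 <= tp * p ^+ k < 1.
  rewrite (mulr_ge0 (ltW tp0) (exprn_ge0 k (ltW p0)))/=.
  by rewrite (le_lt_trans _ tp1)// ler_piMr ?(ltW tp0)// exprn_ile1// ltW.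
have znE : znorm m = calpha n q alpha * \prod_(j < n.+1)
    (qpoch p p (m j) / qpoch (tp * p ^+ (j + mhead m j)) p (m j).+1).
  rewrite prodf_div qpoch_consecutive -/(hnorm2 q m) qpochD /znorm /calpha.
  have : 0 < qpoch tp p n.+1 by apply: qpoch_gt0 => //; rewrite (ltW tp0) tp1.
  have : 0 < qpoch (tp * p ^+ n.+1) p (mdeg m) by exact: qpoch_gt0 (xj _) p01.
  by move=> h1 h2; field; rewrite !gt_eqF.
rewrite znE (_ : ztrunc_norm m = fun K => calpha n q alpha * \prod_(j < n.+1)
    (\sum_(i < K) qpoch p p (m j + i) / qpoch p p i * (tp * p ^+ (j + mhead m j)) ^+ i)).
  apply: cvgM; first exact: cvg_cst.
  apply: cvg_prod_seq => j; apply: qbinomial_series => //; first by rewrite p0.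
apply/funext => K; rewrite /ztrunc_norm -(box_prod K (fun (j : 'I_n.+1) i =>
  qpoch p p (m j + i) / qpoch p p i * (tp * p ^+ (j + mhead m j)) ^+ i)) mulr_sumr.
by apply: eq_bigr => b _; rewrite zweight_prod.
Qed.

Lemma znorm_gt0 m : 0 < znorm m.
Proof.
have /andP[tp0 tp1] := tqsq q01 alpha0; have /andP[p0 p1] := qsq q01.
apply: divr_gt0; first exact: hnorm2_gt0.
apply: qpoch_gt0; last by rewrite !ltW.
rewrite (mulr_ge0 (ltW tp0) (exprn_ge0 _ (ltW p0)))/=.
by rewrite (le_lt_trans _ tp1)// ler_piMr ?(ltW tp0)// exprn_ile1// ltW.
Qed.

Lemma ztrunc_norm_le m K : ztrunc_norm m K <= znorm m.
Proof.
have nd : nondecreasing_seq (ztrunc_norm m).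
  by move=> k l kl; apply: big_box_mono => // b; exact: zweight_ge0.
have cv := @ztrunc_norm_cvg m.
rewrite -(cvg_lim _ cv)//; apply: nondecreasing_cvgn_le => //.
by apply/cvg_ex; exists (znorm m).
Qed.

(** The monomial z^m is not a finite function; it is approximated by its
    restrictions to finitely many columns. *)
Definition ztrunc m k : qop := fun a b => if b \in box k then zmon q m a b else 0.

Lemma ztrunc_boxed m k : boxed (k + mdeg m) (ztrunc m k).
Proof.
move=> a b; rewrite /ztrunc; case: ifPn => [bk|]; last by rewrite eqxx.
have [->|/(zmon_entry0 q01)->] := eqVneq a (m + b); last by rewrite eqxx.
move=> _; rewrite (sub_box (leq_addr _ _) bk) andbT; move: bk; rewrite !mem_box => /forallP bk.
apply/forallP => l; rewrite maddE addnC; apply: leq_trans (_ : b l + m l < k + m l)%N _.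
  by rewrite ltn_add2r bk.
by rewrite leq_add2l /mdeg (bigD1 l)//= leq_addr.
Qed.

(** The norm of the omitted columns is the tail of the convergent series
    [ztrunc_norm]. *)
Lemma ztrunc_approx m : approx (ztrunc m) (zmon q m).
Proof.
apply/approxP; split=> [k|e e0].
  by apply/finite_opP; exists (k + mdeg m)%N; exact: ztrunc_boxed.
have /cvgRP/(_ _ e0)[k0 k0P] := @ztrunc_norm_cvg m; exists k0 => k /k0P.
rewrite ltr_distl => /andP[ke _] K.
pose L := maxn K k.
apply: (@le_trans _ _ (\sum_(b <- box L) if b \in box k then 0 else zweight m b)); last first.
  have : \sum_(b <- box L) (if b \in box k then 0 else zweight m b) =
      ztrunc_norm m L - ztrunc_norm m k.
    rewrite /ztrunc_norm.
    have -> : \sum_(b <- box k) zweight m b =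
        \sum_(b <- box L) if b \in box k then zweight m b else 0.
      rewrite (big_box_widen (K := k) (leq_maxr K k)) => [|b /negPf -> //].
      by rewrite big_seq [RHS]big_seq; apply: eq_bigr => b ->.
    by rewrite -sumrB; apply: eq_bigr => b _; case: ifP => _; rewrite ?subrr ?subr0.
  move=> ->; rewrite lerBlDr; apply: le_trans (ztrunc_norm_le m L) _.
  by rewrite addrC -lerBlDr; exact: ltW.
apply: (@le_trans _ _ (\sum_(b <- box K) if b \in box k then 0 else zweight m b)); last first.
  by apply: big_box_mono; [exact: leq_maxl|move=> b; case: ifP => // _; exact: zweight_ge0].
rewrite /tnorm exchange_big; apply: ler_sum => b _ /=.
case: ifPn => bk.
  rewrite big1// => a _; rewrite [X in nsq X](_ : _ = 0) ?nsq0 ?mul0r//.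
  by rewrite qopB /ztrunc bk subrr.
have w0 : 0 <= zweight m b := zweight_ge0 m b.
have [mbK|mbK] := boolP (m + b \in box K).
  rewrite (big_box1 mbK) => [|a am].
    rewrite qopB /ztrunc (negPf bk) sub0r nsqN zmon_entry// nsqE normc_real.
    by rewrite ger0_norm ?exprn_ge0 ?(ltW q0).
  by rewrite qopB /ztrunc (negPf bk) sub0r nsqN zmon_entry0// nsq0 mul0r.
rewrite big1_seq// => a /andP[_ aK].
rewrite qopB /ztrunc (negPf bk) sub0r nsqN zmon_entry0 ?nsq0 ?mul0r//.
by apply: contraNneq mbK => <-.
Qed.

Lemma zmon_L2 m : L2 (zmon q m).
Proof. by exists (ztrunc m); exact: ztrunc_approx. Qed.

Lemma tdot_ztrunc K f m k : boxed K f ->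
  tdot K f (ztrunc m k) =
  \sum_(b <- box K) if b \in box k then f (m + b) b * (q ^+ cross m b * wt (m + b) b)%:C else 0.
Proof.
move=> fK; rewrite /tdot exchange_big; apply: eq_bigr => b _ /=.
case: ifPn => bk; last first.
  by rewrite big1// => a _; rewrite /ztrunc (negPf bk) conjc0 mulr0 mul0r.
have [mbK|mbK] := boolP (m + b \in box K).
  rewrite (big_box1 mbK) => [|a am].
    by rewrite /ztrunc bk zmon_entry// conjc_real -mulrA -rmorphM.
  by rewrite /ztrunc bk zmon_entry0// conjc0 mulr0 mul0r.
rewrite (boxed_l _ fK mbK) mul0r big1_seq// => a /andP[_ aK].
rewrite /ztrunc bk zmon_entry0 ?conjc0 ?mulr0 ?mul0r//.
by apply: contraNneq mbK => <-.
Qed.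

Lemma dotL2_finite_zmon K f m : boxed K f ->
  dotL2 f (zmon q m) = \sum_(b <- box K) f (m + b) b * (q ^+ cross m b * wt (m + b) b)%:C.
Proof.
move=> fK; have ff : finite_op f by apply/finite_opP; exists K.
apply: (dotL2_lim q01 alpha0 (approx_cst q01 alpha0 ff) (ztrunc_approx m)).
apply/cvgC => e e0; exists K => k Kk.
rewrite (dotE _ fK) tdot_ztrunc//.
rewrite (eq_big_seq (fun b => f (m + b) b * (q ^+ cross m b * wt (m + b) b)%:C)).
  by rewrite subrr normc0.
by move=> b bK; rewrite (sub_box Kk bK).
Qed.

Lemma dotL2_zmon m m' : dotL2 (zmon q m) (zmon q m') = if m == m' then (znorm m)%:C else 0.
Proof.
apply: (dotL2_lim q01 alpha0 (ztrunc_approx m) (ztrunc_approx m')).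
have E k : dot (ztrunc m k) (ztrunc m' k) = if m == m' then (ztrunc_norm m k)%:C else 0.
  rewrite (dotE _ (@ztrunc_boxed m k)) (tdot_ztrunc m' k (@ztrunc_boxed m k)).
  have [<-|mm'] := eqVneq m m'; last first.
    rewrite big1// => b _; case: ifP => // bk; rewrite /ztrunc bk zmon_entry0 ?mul0r//.
    by apply: contraNneq mm' => /maddIr ->.
  rewrite (big_box_widen (K := k) (leq_addr _ _)) => [|b /negPf -> //].
  rewrite /ztrunc_norm rmorph_sum big_seq [RHS]big_seq; apply: eq_bigr => b bk.
  by rewrite bk /ztrunc bk zmon_entry// -rmorphM /zweight mulrA -expr2.
under eq_fun do rewrite E.
case: eqP => _; last exact: cvg_cst.
have /cvgRP zc := @ztrunc_norm_cvg m.
apply/cvgC => e /zc[k0 k0P]; exists k0 => k /k0P.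
by rewrite -rmorphB normc_real.
Qed.

End MonomialNorms.

Lemma ltr_quarter (R : realType) (x y e : R) :
  x < e / 4 -> y < e / 4 -> 2 * x + 2 * y < e.
Proof. lra. Qed.

(** * The orthogonal projection onto the polynomials *)

Section Projection.
Variables (R : realType) (n : nat) (q : R).
Hypothesis q01 : 0 < q < 1.
Local Notation C := R[i]^o.
Local Notation box := (box n).
Local Notation qop := (qop R n).
Implicit Types (a b m d x : mi n) (f g F G H : qop) (e s : R) (c : mi n -> C).

Definition zcomb K c : qop := \sum_(m <- box K) c m *: (zmon q m : qop).

Lemma hol_zcomb K c : (forall m, m \notin box K -> c m = 0) -> is_hol_coord q (zcomb K c) c.
Proof.
move=> cK; split.
  apply: (sub_finite_set _ (finite_box n K)) => m /=.
  by apply: contraNT => /cK ->.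
by rewrite (big_box (K := K))// => m /cK ->; rewrite scale0r.
Qed.

Lemma hol_coordP f c : is_hol_coord q f c ->
  exists2 K, (forall m, m \notin box K -> c m = 0) & f = zcomb K c.
Proof.
move=> [/box_finite[K cK] ->]; have c0 m : m \notin box K -> c m = 0.
  by move=> mK; apply/eqP; apply: contraNT mK => /cK.
by exists K => //; rewrite (big_box (K := K))// => m /c0 ->; rewrite scale0r.
Qed.

Lemma qop_sumE (T : Type) (r : seq T) (h : T -> qop) a b :
  (\sum_(i <- r) h i) a b = \sum_(i <- r) h i a b.
Proof. by rewrite fct_sumE fct_sumE. Qed.

Lemma hol_entry f c m b : is_hol_coord q f c -> f (m + b) b = c m * (q ^+ cross m b)%:C.
Proof.
move=> /hol_coordP[K cK ->]; rewrite /zcomb qop_sumE.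
have [mK|mK] := boolP (m \in box K).
  by rewrite (big_box1 mK) => [|m' mm']; rewrite qopZ ?zmon_entry// zmon_entry0 ?mulr0//;
    apply: contraNneq mm' => /maddIr ->.
rewrite (cK _ mK) mul0r big1_seq// => m' /andP[_ m'K].
rewrite qopZ zmon_entry0 ?mulr0//; apply: contraNneq mK => /maddIr ->.
by [].
Qed.

Lemma hol_entry0 f c a b : is_hol_coord q f c -> (forall m, a != m + b) -> f a b = 0.
Proof.
move=> /hol_coordP[K cK ->] ab; rewrite /zcomb qop_sumE big1// => m _.
by rewrite qopZ zmon_entry0// mulr0.
Qed.

Lemma hol_coordE f c : is_hol_coord q f c -> hol_coord q f = c.
Proof.
move=> fc; apply: xget_unique => // c' fc'; apply/funext => m.
have := hol_entry m 0 fc; have := hol_entry m 0 fc'.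
by rewrite crossm0 expr0 !mulr1 => <- ->.
Qed.

Lemma hol_zmon m : is_hol_coord q (zmon q m) (fun m' => (m' == m)%:R).
Proof.
have mK : m \in box (mdeg m).+1 by exact: mdeg_box.
have -> : zmon q m = zcomb (mdeg m).+1 (fun m' => (m' == m)%:R).
  by rewrite /zcomb (big_box1 mK) ?eqxx ?scale1r// => m' /negPf ->; rewrite scale0r.
by apply: hol_zcomb => m'; case: eqP => // ->; rewrite mK.
Qed.

Variable alpha : R.
Hypothesis alpha0 : 0 < alpha.
Local Notation wt := (wt q alpha).
Local Notation dotL2 := (Defs.dotL2 q alpha).
Local Notation L2 := (Defs.L2 q alpha).
Local Notation nrm2 := (nrm2 q alpha).
Local Notation hol_closure := (Defs.hol_closure q alpha).
Local Notation proj := (Defs.proj q alpha).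
Local Notation znorm := (znorm q alpha).

Let zL2 m : L2 (zmon q m). Proof. exact: zmon_L2. Qed.

Lemma L2_0 : L2 (0 : qop).
Proof.
apply: L2_finite => //; apply/finite_opP; exists 0%N => a b.
by rewrite (_ : (0 : qop) a b = 0)// eqxx.
Qed.

Lemma zcomb_L2 K c : L2 (zcomb K c).
Proof.
rewrite /zcomb; elim: (box K) => [|m r IH]; first by rewrite big_nil; exact: L2_0.
by rewrite big_cons; exact: (L2D q01 alpha0 (L2Z q01 alpha0 (c m) (zL2 m)) IH).
Qed.

Lemma dotL2_zcomb K c H : L2 H ->
  dotL2 (zcomb K c) H = \sum_(m <- box K) c m * dotL2 (zmon q m) H.
Proof.
move=> LH; rewrite /zcomb; have : L2 (\sum_(m <- box K) c m *: (zmon q m : qop)) /\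
  dotL2 (\sum_(m <- box K) c m *: (zmon q m : qop)) H = \sum_(m <- box K) c m * dotL2 (zmon q m) H.
  elim: (box K) => [|m r [IH1 IH2]].
    rewrite !big_nil; split; first exact: L2_0.
    by rewrite -(scale0r (0 : qop)) (dotL2Zl q01 alpha0 0 L2_0 LH) mul0r.
  rewrite !big_cons; have Lz := L2Z q01 alpha0 (c m) (zL2 m).
  split; first exact: (L2D q01 alpha0 Lz IH1).
  by rewrite (dotL2Dl q01 alpha0 Lz IH1 LH) (dotL2Zl q01 alpha0 (c m) (zL2 m) LH) IH2.
by case.
Qed.

Lemma dotL2_zcomb_zmon K c m : (forall m, m \notin box K -> c m = 0) ->
  dotL2 (zcomb K c) (zmon q m) = c m * (znorm m)%:C.
Proof.
move=> cK; rewrite dotL2_zcomb//.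
have [mK|mK] := boolP (m \in box K).
  rewrite (big_box1 mK) => [|m' /negPf mm']; first by rewrite dotL2_zmon// eqxx.
  by rewrite dotL2_zmon// mm' mulr0.
rewrite (cK _ mK) mul0r big1_seq// => m' /andP[_ m'K].
rewrite dotL2_zmon//; case: eqP => [mm'|]; last by rewrite mulr0.
by rewrite mm' (negPf mK) in m'K.
Qed.

Lemma hol_L2 f : hol q f -> L2 f.
Proof. by move=> [c /hol_coordP[K _ ->]]; exact: zcomb_L2. Qed.

Lemma holB f g : hol q f -> hol q g -> hol q (f - g).
Proof.
move=> [c /hol_coordP[K1 c0 ->]] [c' /hol_coordP[K2 c'0 ->]].
have h1 : zcomb K1 c = zcomb (maxn K1 K2) c.
  by rewrite /zcomb (big_box_widen (leq_maxl K1 K2))// => m /c0 ->; rewrite scale0r.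
have h2 : zcomb K2 c' = zcomb (maxn K1 K2) c'.
  by rewrite /zcomb (big_box_widen (leq_maxr K1 K2))// => m /c'0 ->; rewrite scale0r.
exists (fun m => c m - c' m); rewrite h1 h2.
have -> : zcomb (maxn K1 K2) c - zcomb (maxn K1 K2) c' = zcomb (maxn K1 K2) (fun m => c m - c' m).
  by rewrite /zcomb -sumrB; apply: eq_bigr => m _; rewrite scalerBl.
apply: hol_zcomb => m mK.
rewrite c0 ?c'0 ?subrr//.
  by apply: contra mK; apply: sub_box; exact: leq_maxr.
by apply: contra mK; apply: sub_box; exact: leq_maxl.
Qed.

Lemma closureP G : hol_closure G <-> L2 G /\
  forall e, 0 < e -> exists2 f, hol q f & nrm2 (G - f) < e.
Proof.
split=> -[LG H]; split=> // e; [move=> e0|move=> /posC[d d0 ->]].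
  have e0' : 0 < e%:C :> R[i] by rewrite ltcR.
  have [f hf] := H _ e0'; rewrite (dotL2_nrm2 q01 alpha0 (L2B q01 alpha0 LG (hol_L2 hf))) ltcR.
  by exists f.
have [f hf h] := H _ d0; exists f => //.
by rewrite (dotL2_nrm2 q01 alpha0 (L2B q01 alpha0 LG (hol_L2 hf))) ltcR.
Qed.

Lemma hol_closed f : hol q f -> hol_closure f.
Proof.
move=> hf; apply/closureP; split=> [|e e0]; first exact: hol_L2.
exists f => //; rewrite subrr /nrm2 -[X in dotL2 X _](scale0r (0 : qop)).
by rewrite (dotL2Zl q01 alpha0 0 L2_0 L2_0) mul0r.
Qed.

Lemma closureB G G' : hol_closure G -> hol_closure G' -> hol_closure (G - G').
Proof.
move=> /closureP[LG HG] /closureP[LG' HG']; apply/closureP; split=> [|e e0].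
  exact: (L2B q01 alpha0 LG LG').
have e40 : 0 < e / 4 by rewrite divr_gt0.
have [f hf fe] := HG _ e40; have [f' hf' fe'] := HG' _ e40.
exists (f - f'); first exact: holB.
have LGf := L2B q01 alpha0 LG (hol_L2 hf); have LGf' := L2B q01 alpha0 LG' (hol_L2 hf').
rewrite (_ : G - G' - (f - f') = (G - f) - (G' - f')); last by rewrite opprD addrACA -opprD.
apply: le_lt_trans (nrm2B_le q01 alpha0 LGf LGf') _.
exact: ltr_quarter fe fe'.
Qed.

(** H is orthogonal to all polynomials, so (H, G) = (H, G - f) for every
    polynomial f, and G - f can be made arbitrarily small. *)
Lemma closure_orthogonal H G : L2 H -> (forall m, dotL2 H (zmon q m) = 0) ->
  hol_closure G -> dotL2 H G = 0.
Proof.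
move=> LH H0 /closureP[LG HG].
have Hp f : hol q f -> dotL2 H f = 0.
  move=> hf; rewrite (dotL2C q01 alpha0 (hol_L2 hf) LH); case: hf => c /hol_coordP[K _ ->].
  rewrite dotL2_zcomb// big1 ?conjc0// => m _.
  by rewrite (dotL2C q01 alpha0 LH (zL2 m)) H0 conjc0 mulr0.
apply: eq0_normc; apply/eqP; rewrite eq_le normc_ge0 andbT.
apply/ler_addgt0Pr => e e0; rewrite add0r.
have N0 := nrm2_ge0 q01 alpha0 LH.
have N1 : 0 < nrm2 H + 1 by rewrite ltr_wpDl.
(* This s makes the first term of dotL2_young at most e / 2; then f is chosen
   so close to G that the second one is at most e / 2 too. *)
pose s := e / 2 / (nrm2 H + 1); have s0 : 0 < s by rewrite !divr_gt0.
have se : 0 < s * (e / 2) by rewrite mulr_gt0// divr_gt0.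
have [f hf fe] := HG _ se.
have -> : dotL2 H G = dotL2 H (G - f).
  by rewrite (dotL2Br q01 alpha0 LG (hol_L2 hf) LH) (Hp _ hf) subr0.
apply: le_trans (dotL2_young q01 alpha0 LH (L2B q01 alpha0 LG (hol_L2 hf)) s0) _.
rewrite [e]splitr; apply: lerD.
  by rewrite /s mulrAC ler_pdivrMr// ler_pM2l ?divr_gt0// lerDl.
by rewrite ler_pdivrMr// mulrC ltW.
Qed.

(** The difference D of two candidates lies in the closure of the polynomials
    and is orthogonal to it, hence (D, D) = 0. *)
Lemma proj_unique F G : L2 F -> hol_closure G -> (forall m, dotL2 (F - G) (zmon q m) = 0) ->
  proj F = G.
Proof.
move=> LF cG FG; have LG : L2 G by case: cG.
have LFG := L2B q01 alpha0 LF LG.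
apply: xget_unique => [|G' [cG' FG']].
  by split=> // G' cG'; exact: closure_orthogonal.
have LG' : L2 G' by case: cG'.
have LD := L2B q01 alpha0 LG LG'.
have h1 := FG' _ (closureB cG cG'); have h2 := closure_orthogonal LFG FG (closureB cG cG').
apply/esym/eqP; rewrite -subr_eq0; apply/eqP; apply: (nrm2_eq0 q01 alpha0 LD).
have : dotL2 (G - G') (G - G') = 0.
  rewrite -[X in dotL2 X _](_ : (F - G') - (F - G) = _); last by rewrite opprB addrC subrKA.
  by rewrite (dotL2Bl q01 alpha0 (L2B q01 alpha0 LF LG') LFG LD) h1 h2 subrr.
by rewrite (dotL2_nrm2 q01 alpha0 LD) => -[->].
Qed.

Lemma proj_finite K f : boxed K f ->
  is_hol_coord q (proj f) (fun m => (znorm m)^-1%:C *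
    \sum_(b <- box K) f (m + b) b * (q ^+ cross m b * wt (m + b) b)%:C).
Proof.
move=> fK; set c := fun m => _.
have cK m : m \notin box K -> c m = 0.
  move=> mK; rewrite /c big1 ?mulr0// => b _; rewrite (boxed_l _ fK) ?mul0r//.
  by apply: contra mK => /box_add/andP[].
have Lf : L2 f by apply: L2_finite => //; apply/finite_opP; exists K.
rewrite (_ : proj f = zcomb K c); first exact: hol_zcomb.
apply: (proj_unique Lf).
  by apply: hol_closed; exists c; exact: hol_zcomb.
move=> m; rewrite (dotL2Bl q01 alpha0 Lf (zcomb_L2 K c) (zL2 m)).
rewrite dotL2_zcomb_zmon// (dotL2_finite_zmon q01 alpha0 m fK).
rewrite /c mulrAC -rmorphM/= mulVf ?mul1r ?subrr//.
by rewrite gt_eqF// znorm_gt0.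
Qed.

End Projection.

(** * Toeplitz operators and the q-trace *)

Section Toeplitz.
Variables (R : realType) (n : nat) (q : R).
Hypothesis q01 : 0 < q < 1.
Variable alpha : R.
Hypothesis alpha0 : 0 < alpha.
Local Notation C := R[i]^o.
Local Notation box := (box n).
Local Notation qop := (qop R n).
Local Notation p := (q ^+ 2).
Local Notation wt := (wt q alpha).
Local Notation znorm := (znorm q alpha).
Local Notation zweight := (zweight q alpha).
Local Notation toeplitz := (toeplitz q alpha).
Implicit Types (a b m d x : mi n) (f g F G H : qop) (e s : R) (c : mi n -> C).

Lemma qmul_boxed K f u c : boxed K f -> is_hol_coord q u c -> boxed K (qmul f u).
Proof.
move=> fK uc a b; apply: contraR => abK.
rewrite /qmul fsbig1// => d _; apply/eqP; apply: contraNT abK.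
rewrite mulf_eq0 negb_or => /andP[/fK/andP[-> dK] udb]; apply/andP; split=> //.
have [m dm] : exists m, d = m + b.
  apply: contrapT => no; move: udb; rewrite (hol_entry0 q01 uc) ?eqxx// => m.
  by apply/eqP => dm; apply: no; exists m.
by move: dK; rewrite dm => /box_add/andP[].
Qed.

Lemma toeplitz_coord K f u c : boxed K f -> is_hol_coord q u c ->
  is_hol_coord q (toeplitz f u) (fun m => (znorm m)^-1%:C *
    \sum_(b <- box K) qmul f u (m + b) b * (q ^+ cross m b * wt (m + b) b)%:C).
Proof. by move=> fK uc; apply: (proj_finite q01 alpha0 (qmul_boxed fK uc)). Qed.

Lemma qmul_zmon f m a b : qmul f (zmon q m) a b = f a (m + b) * (q ^+ cross m b)%:C.
Proof.
rewrite /qmul (fsum1 (b := m + b)) ?zmon_entry// => d dm.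
by rewrite zmon_entry0// mulr0.
Qed.

Definition diag_op (phi : mi n -> C) : qop := fun a b => (a == b)%:R * phi b.

Lemma qmul_diag_l phi f a b : qmul (diag_op phi) f a b = phi a * f a b.
Proof.
rewrite /qmul (fsum1 (b := a)) /diag_op ?eqxx ?mul1r// => d da.
by rewrite eq_sym (negPf da) !mul0r.
Qed.

(** The scalar by which the Toeplitz operator of the diagonal function phi
    multiplies z^m. *)
Definition eigen K (phi : mi n -> C) m : C :=
  (znorm m)^-1%:C * \sum_(b <- box K) phi (m + b) * (zweight m b)%:C.

Lemma toeplitz_diag K phi u c : boxed K (diag_op phi) -> is_hol_coord q u c ->
  is_hol_coord q (toeplitz (diag_op phi) u) (fun m => eigen K phi m * c m).
Proof.
move=> phiK uc; have := toeplitz_coord phiK uc; congr is_hol_coord.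
apply/funext => m; rewrite /eigen -mulrA; congr (_ * _).
rewrite mulr_suml; apply: eq_bigr => b _; rewrite qmul_diag_l (hol_entry q01 m b uc).
rewrite /zweight !rmorphM/=; ring.
Qed.

Definition trace_term K (phi : mi n -> C) g m : C :=
  eigen K phi m *
  ((znorm m)^-1%:C * \sum_(b <- box K) g (m + b) (m + b) * (zweight m b)%:C) *
  (wnu q m)%:C.

Lemma qtrace_toeplitz K phi g : boxed K (diag_op phi) -> boxed K g ->
  qtrace q alpha (toeplitz (diag_op phi) \o toeplitz g) =
  (qpoch p p n.+1 / calpha n q alpha)%:C * \sum_(m <- box K) trace_term K phi g m.
Proof.
move=> phiK gK; rewrite /qtrace [2 + 2 * alpha]addrC powR_tq2// -/(calpha n q alpha); congr (_ * _).
have E m : hol_coord q ((toeplitz (diag_op phi) \o toeplitz g) (zmon q m)) m =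
    eigen K phi m * ((znorm m)^-1%:C * \sum_(b <- box K) g (m + b) (m + b) * (zweight m b)%:C).
  have h := toeplitz_diag phiK (toeplitz_coord gK (hol_zmon q m)).
  rewrite /comp (hol_coordE q01 h); congr (_ * (_ * _)); apply: eq_bigr => b _.
  rewrite qmul_zmon /zweight !rmorphM/=; ring.
rewrite (big_box (K := K)) => [|m mK].
  by apply: eq_bigr => m _; rewrite E /trace_term.
rewrite E [\sum_(b <- _) g _ _ * _]big1 ?mulr0 ?mul0r// => b _.
rewrite (boxed_l _ gK) ?mul0r//; apply: contra mK => /box_add/andP[].
by [].
Qed.

End Toeplitz.

(** * The Berezin transform of a diagonal finite function *)

Section Berezin.
Variables (R : realType) (n : nat) (q : R).
Hypothesis q01 : 0 < q < 1.
Local Notation C := R[i]^o.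
Local Notation box := (box n).
Local Notation qop := (qop R n).
Local Notation p := (q ^+ 2).
Implicit Types (a b m d x : mi n) (f g F G H S : qop) (e s : R) (phi : mi n -> C).

Lemma wnu_neq0 x : (wnu q x)%:C != 0 :> R[i].
Proof. by rewrite fmorph_eq0 gt_eqF// wnu_gt0. Qed.

Lemma qq_neq0 : (qpoch p p n.+1)%:C != 0 :> R[i].
Proof.
have /andP[p0 p1] := qsq q01; rewrite fmorph_eq0 gt_eqF// qpoch_gt0// ?p1 ?(ltW p0)//.
by rewrite ltW.
Qed.

Definition unit_op x y : qop := fun a b => ((a == x) && (b == y))%:R.

Lemma unit_op_boxed x y : exists K, boxed K (unit_op x y).
Proof.
exists (maxn (mdeg x) (mdeg y)).+1 => a b; rewrite /unit_op.
case: (a =P x) => [->|]; case: (b =P y) => [->|]; rewrite ?eqxx//= => _.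
by rewrite !mdeg_box// ltnS ?leq_maxl ?leq_maxr.
Qed.

Lemma int_nu_mul_diag K phi g : boxed K g ->
  int_nu q (qmul (diag_op phi) g) = (qpoch p p n.+1)%:C *
    \sum_(x <- box K) phi x * g x x * (wnu q x)%:C.
Proof.
move=> gK; rewrite (int_nuE (K := K) q01) => [|b bK].
  by congr (_ * _); apply: eq_bigr => b _; rewrite qmul_diag_l.
by rewrite qmul_diag_l (boxed_l _ gK bK) mulr0.
Qed.

(** Pairing with a matrix unit reads off one entry, which is why
    distributions are determined by their pairings. *)
Lemma int_nu_unit S x y : int_nu q (qmul S (unit_op y x)) =
  (qpoch p p n.+1)%:C * (S x y * (wnu q x)%:C).
Proof.
have E b : qmul S (unit_op y x) b b = (b == x)%:R * S b y.
  rewrite /qmul (fsum1 (b := y)) => [|d /negPf dy]; rewrite /unit_op.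
    by rewrite eqxx mulrC.
  by rewrite dy mulr0.
rewrite (int_nuE (K := (mdeg x).+1) q01) => [|b bK]; last first.
  rewrite E; case: eqP bK => [->|_ _]; last by rewrite mul0r.
  by rewrite mdeg_box.
have xK : x \in box (mdeg x).+1 by exact: mdeg_box.
rewrite (big_box1 xK) => [|b /negPf bx]; rewrite E ?eqxx ?mul1r//.
by rewrite bx !mul0r.
Qed.

Lemma int_nu_inj S S' :
  (forall g, finite_op g -> int_nu q (qmul S g) = int_nu q (qmul S' g)) -> S = S'.
Proof.
move=> SS; apply/funext => x; apply/funext => y.
have [K uK] := unit_op_boxed y x.
have := SS (unit_op y x) _; rewrite !int_nu_unit => h.
by apply: (mulIf (wnu_neq0 x)); apply: (mulfI qq_neq0); apply: h; apply/finite_opP; exists K.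
Qed.

Variable alpha : R.
Hypothesis alpha0 : 0 < alpha.
Local Notation znorm := (znorm q alpha).
Local Notation zweight := (zweight q alpha).
Local Notation toeplitz := (toeplitz q alpha).
Local Notation calpha := (calpha n q alpha).

Definition berezin_term K phi m b : C :=
  eigen q alpha K phi m * ((znorm m)^-1 * zweight m b * wnu q m)%:C.

Definition berezin_diag K phi x : C :=
  (wnu q x * calpha)^-1%:C * \sum_(m <- box (mdeg x).+1) \sum_(b <- box (mdeg x).+1)
    (x == m + b)%:R * berezin_term K phi m b.

(** The decompositions x = m + b of a multi-index only involve m and b below x. *)
Lemma sum_fibre (V : pzSemiRingType) K L x (h : mi n -> mi n -> V) : x \in box K -> x \in box L ->
  \sum_(m <- box K) \sum_(b <- box K) (x == m + b)%:R * h m b =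
  \sum_(m <- box L) \sum_(b <- box L) (x == m + b)%:R * h m b.
Proof.
wlog KL : K L / (K <= L)%N => [W xK xL|xK xL].
  by have [KL|/ltnW LK] := leqP K L; [apply: W | apply/esym; apply: W].
have h0 m b : (m \notin box K) || (b \notin box K) -> (x == m + b)%:R * h m b = 0.
  case: eqP => [xmb|]; last by rewrite mul0r.
  by move: xK; rewrite xmb => /box_add/andP[-> ->].
rewrite (big_box_widen KL) => [|m mK]; last by rewrite big1// => b _; rewrite h0// mK.
by apply: eq_bigr => m _; rewrite (big_box_widen KL)// => b bK; rewrite h0// bK orbT.
Qed.

Lemma boxed_phi K phi m : boxed K (diag_op phi) -> m \notin box K -> phi m = 0.
Proof.
by move=> phiK mK; have := boxed_l m phiK mK; rewrite /diag_op eqxx mul1r.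
Qed.

Lemma eigen_widen K L phi m : (K <= L)%N -> boxed K (diag_op phi) ->
  eigen q alpha L phi m = eigen q alpha K phi m.
Proof.
move=> KL phiK; rewrite /eigen (big_box_widen KL)// => b bK.
by rewrite (boxed_phi phiK) ?mul0r//; apply: contra bK => /box_add/andP[].
Qed.

(** Writing x = m + b in the trace of [qtrace_toeplitz] turns it into the
    pairing of g with a diagonal matrix. *)
Lemma berezinE K phi : boxed K (diag_op phi) ->
  berezin q alpha (diag_op phi) = diag_op (berezin_diag K phi).
Proof.
move=> phiK.
have key g : finite_op g -> int_nu q (qmul (diag_op (berezin_diag K phi)) g) =
    qtrace q alpha (toeplitz (diag_op phi) \o toeplitz g).
  move=> /finite_opP[K' gK'].
  pose L := maxn K K'.
  have gL := boxed_widen (leq_maxr K K') gK'; have phiL := boxed_widen (leq_maxl K K') phiK.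
  rewrite (int_nu_mul_diag _ gL) (qtrace_toeplitz q01 alpha0 phiL gL) rmorphM/= -mulrA.
  congr (_ * _).
  have c0 : calpha != 0 by rewrite gt_eqF// calpha_gt0.
  transitivity (\sum_(x <- box L) calpha^-1%:C * \sum_(m <- box L) \sum_(b <- box L)
      (x == m + b)%:R * (g x x * berezin_term K phi m b)).
    rewrite big_seq [RHS]big_seq; apply: eq_bigr => x xL.
    rewrite /berezin_diag (@sum_fibre _ _ L x _ (mdeg_box (ltnSn _)) xL).
    have e : (wnu q x * calpha)^-1%:C * (wnu q x)%:C = calpha^-1%:C :> C.
      by rewrite -rmorphM/= invfM mulrAC mulVf ?mul1r// gt_eqF// wnu_gt0.
    rewrite -e; set s := \sum_(m <- _) _.
    have -> : \sum_(m <- box L) \sum_(b <- box L)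
        (x == m + b)%:R * (g x x * berezin_term K phi m b) = g x x * s.
      rewrite /s mulr_sumr; apply: eq_bigr => m _; rewrite mulr_sumr.
      by apply: eq_bigr => b _; rewrite mulrCA.
    by move: (_^-1)%:C s (wnu q x)%:C (g x x) => u v w t; clear - u; ring.
  rewrite -mulr_sumr; congr (_ * _); rewrite exchange_big; apply: eq_bigr => m _ /=.
  rewrite exchange_big /trace_term /= mulrAC [X in _ = _ * X]mulr_sumr mulr_sumr.
  apply: eq_bigr => b _; rewrite (eigen_widen _ (leq_maxl K K') phiK) /berezin_term.
  have [mbL|mbL] := boolP (m + b \in box L).
    rewrite (big_box1 mbL) => [|x /negPf ->]; last by rewrite mul0r.
    by rewrite eqxx mul1r !rmorphM/=; ring.
  rewrite (boxed_l _ gL mbL) mul0r !mulr0 big1_seq// => x /andP[_ xL].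
  by case: eqP => [xmb|]; [rewrite xmb (negPf mbL) in xL|rewrite mul0r].
rewrite /berezin /symbol; apply: xget_unique => [|S hS]; first exact: key.
by apply: int_nu_inj => g fg; rewrite hS// key.
Qed.

End Berezin.

(** * The Berezin transform as a polynomial in the deformation parameter *)

Section SymbolPolynomial.
Variables (R : realType) (n : nat) (q : R).
Hypothesis q01 : 0 < q < 1.
Local Notation C := R[i]^o.
Local Notation box := (box n).
Local Notation p := (q ^+ 2).
Implicit Types (a b m d x : mi n) (c : R).
Let p1 : p < 1. Proof. by case/andP: (qsq q01). Qed.

(** The polynomial in t with value (t c; p)_r. *)
Definition qpochX c r : {poly R} := \prod_(j < r) (1 - (c * p ^+ j) *: 'X).

Lemma qpochX_eval c r t : (qpochX c r).[t] = qpoch (t * c) p r.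
Proof.
rewrite horner_prod; apply: eq_bigr => j _.
rewrite !hornerE; ring.
Qed.

Lemma qpochX_coef0 c r : (qpochX c r)`_0 = 1.
Proof. by rewrite -horner_coef0 qpochX_eval mul0r /qpoch big1// => j _; rewrite mul0r subr0. Qed.

Lemma coef1M (u v : {poly R}) : (u * v)`_1 = u`_0 * v`_1 + u`_1 * v`_0.
Proof. by rewrite coefM big_ord_recl big_ord1. Qed.

Lemma qpochX_coef1 c r : (qpochX c r)`_1 = - c * (1 - p ^+ r) / (1 - p).
Proof.
have h : 1 - p != 0 by rewrite subr_eq0 gt_eqF.
elim: r => [|r IH].
  by rewrite /qpochX big_ord0 coef1 expr0 subrr mulr0 mul0r.
rewrite /qpochX big_ord_recr/= -/(qpochX c r) coef1M qpochX_coef0 IH.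
rewrite !coefB !coef1 !coefZ !coefX /= [p ^+ r.+1]exprSr.
by move: (p ^+ r) h => y h; field.
Qed.

(** The dependence on t of one term of the symbol, where e = |b| + |d|. *)
Definition kernelX r e : {poly R} :=
  qpochX p n.+1 * qpochX (p ^+ n.+2) r ^+ 2 * (p *: 'X) ^+ e.

Lemma kernelX_coef1 r e : (kernelX r e)`_1 =
  if e == 0%N then (- p * (1 - p ^+ n.+1) - 2 * p ^+ n.+2 * (1 - p ^+ r)) / (1 - p)
  else if e == 1%N then p else 0.
Proof.
have h : 1 - p != 0 by rewrite subr_eq0 gt_eqF.
rewrite /kernelX; set A := _ * _ ^+ 2.
have A0 : A`_0 = 1 by rewrite /A [_ ^+ 2]expr2 !coef0M !qpochX_coef0 !mulr1.
case: e => [|[|e]].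
- rewrite expr0 mulr1 /A [qpochX (p ^+ n.+2) r ^+ 2]expr2 !coef1M !coef0M.
  rewrite !qpochX_coef0 !qpochX_coef1 /= [p ^+ n.+2]exprS.
  by move: (p ^+ n.+1) (p ^+ r) h => y1 y2 h; field.
- by rewrite expr1 coef1M A0 !coefZ !coefX/=; ring.
rewrite exprZn coef1M !coefZ !coefXn/=; ring.
Qed.

Definition zeta m b : R := (q ^+ cross m b) ^+ 2 * (hnorm2 q (m + b) / hnorm2 q b * rho q b).

(** The part of a term of the symbol that is independent of t. *)
Definition kappa x m b d : R :=
  wnu q m / wnu q x * (zeta m b * zeta m d) / hnorm2 q m ^+ 2.

Definition symbolX k x : {poly R} :=
  \sum_(m <- box (mdeg x).+1) \sum_(d <- box (mdeg x).+1) (x == m + d)%:R *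
    \sum_(b <- box k.+1) (mdeg (m + b) == k)%:R *
      (kappa x m b d *: kernelX (mdeg m) (mdeg b + mdeg d)).

(** The function f_k, as a function of the multi-index of the basis vector. *)
Definition level k b : C := (mdeg b == k)%:R.

Lemma level_boxed k : boxed k.+1 (diag_op (level k)).
Proof.
move=> a b; rewrite /diag_op /level; case: (a =P b) => [->|]; last by rewrite mul0r eqxx.
case: (mdeg b =P k) => [<- _|_]; last by rewrite mulr0 eqxx.
by rewrite mdeg_box.
Qed.

Lemma symbolX_eval alpha k x : 0 < alpha ->
  berezin_diag q alpha k.+1 (level k) x = ((symbolX k x).[q `^ (2 * alpha)])%:C.
Proof.
move=> alpha0; rewrite /berezin_diag -/(tq q alpha) /symbolX.
rewrite horner_sum rmorph_sum mulr_sumr; apply: eq_bigr => m _.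
rewrite horner_sum rmorph_sum mulr_sumr; apply: eq_bigr => d _.
rewrite /berezin_term /eigen.
case: eqP => _; last by rewrite !mul0r mulr0 horner0.
rewrite !mul1r horner_sum rmorph_sum !mulr_sumr !mulr_suml mulr_sumr; apply: eq_bigr => b _.
rewrite /level; case: eqP => _; last by rewrite !(mul0r, mulr0) horner0.
rewrite !mul1r -!rmorphM/=; congr (_%:C).
have hm : 0 < hnorm2 q m := hnorm2_gt0 m q01.
have tp := tqsq q01 alpha0.
have Q0 := znorm_gt0 q01 alpha0 m.
have c0 := calpha_gt0 n q01 alpha0.
have w0 := wnu_gt0 q01 x.
have W y : zweight q alpha m y = calpha n q alpha * (tq q alpha * p) ^+ mdeg y * zeta m y.
  by rewrite /zweight wtE /zeta /mu; ring.
have Z : (znorm q alpha m)^-1 = qpoch (tq q alpha * p ^+ n.+2) p (mdeg m) / hnorm2 q m.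
  by rewrite /znorm invf_div -mulrA -exprS.
rewrite !W Z /kappa /kernelX hornerZ !hornerM !horner_exp !hornerZ hornerX !qpochX_eval.
rewrite -/(calpha n q alpha) [p * tq _ _]mulrC exprD; field.
by rewrite !gt_eqF.
Qed.

End SymbolPolynomial.

(** * The linear coefficient *)

Section LinearCoefficient.
Variables (R : realType) (n : nat) (q : R).
Hypothesis q01 : 0 < q < 1.
Local Notation box := (box n).
Local Notation p := (q ^+ 2).
Implicit Types (a b m d x : mi n) (j : 'I_n.+1).
Let q0 : 0 < q. Proof. by case/andP: q01. Qed.
Let p0 : 0 < p. Proof. by case/andP: (qsq q01). Qed.
Let p1 : p < 1. Proof. by case/andP: (qsq q01). Qed.
Let np1 : 1 - p != 0. Proof. by rewrite subr_eq0 gt_eqF. Qed.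

Lemma mdeg_eq0 b : mdeg b = 0%N -> b = 0.
Proof.
move=> b0; apply: mext => l; rewrite ffunE; apply/eqP; rewrite -leqn0.
by rewrite -b0 /mdeg (bigD1 l)//= leq_addr.
Qed.

Lemma munit_inj : injective (@munit n).
Proof.
move=> i j /ffunP/(_ i); rewrite !ffunE eqxx; case: eqP => // _.
Qed.

Lemma mdeg_eq1 b : mdeg b = 1%N -> exists j, b = munit j.
Proof.
move=> b1; have [j bj] : exists j, (0 < b j)%N.
  apply: contrapT => no; suff b0 : b = 0 by rewrite b0 mdeg0 in b1.
  apply: mext => l; rewrite ffunE; apply/eqP; rewrite -leqn0 leqNgt.
  by apply/negP => bl; apply: no; exists l.
exists j; have E : b = munit j + Defs.down j b.
  apply: mext => l; rewrite maddE !ffunE; case: eqP => [->|_]; last by rewrite subn0.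
  by rewrite subnKC.
rewrite E; have /mdeg_eq0 -> : mdeg (Defs.down j b) = 0%N.
  by move: b1; rewrite {1}E mdegD mdeg_munit => -[].
by rewrite addr0.
Qed.

(** The multi-indices of degree at most one are 0 and the unit vectors. *)
Lemma sum_mdeg_le1 K (h : mi n -> R) : (1 < K)%N -> (forall b, (1 < mdeg b)%N -> h b = 0) ->
  \sum_(b <- box K) h b = h 0 + \sum_j h (munit j).
Proof.
move=> K1 h0.
have split b : h b = (b == 0)%:R * h b + \sum_j (b == munit j)%:R * h b.
  have [/h0 hb|] := ltnP 1 (mdeg b).
    by rewrite hb mulr0 big1 ?addr0// => j _; rewrite mulr0.
  rewrite leq_eqVlt ltnS leqn0 => /orP[/eqP/mdeg_eq1[j ->]|/eqP/mdeg_eq0 ->].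
    have -> : munit j == 0 = false.
      by apply/eqP => /(congr1 (@mdeg n)); rewrite mdeg0 mdeg_munit.
    rewrite mul0r add0r (bigD1 j)//= eqxx mul1r big1 ?addr0// => i ij.
    by rewrite (inj_eq munit_inj) eq_sym (negPf ij) mul0r.
  rewrite eqxx mul1r big1 ?addr0// => j _; case: eqP => [|_]; last by rewrite mul0r.
  by move/(congr1 (@mdeg n)); rewrite mdeg0 mdeg_munit.
rewrite (eq_bigr _ (fun b _ => split b)) big_split/=; congr (_ + _).
  have z : (0 : mi n) \in box K by rewrite mdeg_box// mdeg0 (ltnW K1).
  by rewrite (big_box1 z) ?eqxx ?mul1r// => b /negPf ->; rewrite mul0r.
rewrite exchange_big; apply: eq_bigr => j _.
have z : munit j \in box K by rewrite mdeg_box// mdeg_munit.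
by rewrite (big_box1 z) ?eqxx ?mul1r// => b /negPf ->; rewrite mul0r.
Qed.

Lemma hnorm2_0 : hnorm2 q (0 : mi n) = 1.
Proof. by rewrite /hnorm2 big1// => j _; rewrite ffunE qpoch0. Qed.

Lemma hnorm2_munit x j : hnorm2 q (x + munit j) = hnorm2 q x * (1 - p ^+ (x j).+1).
Proof.
rewrite /hnorm2 (bigD1 j)//= [in RHS](bigD1 j)//= maddE ffunE eqxx addn1 qpochS -exprS.
rewrite [RHS]mulrAC; congr (_ * _); apply: eq_bigr => i /negPf ij.
by rewrite maddE ffunE ij addn0.
Qed.

Lemma rho0 : rho q (0 : mi n) = 1.
Proof. by rewrite (rhoE q01) big1// => j _; rewrite ffunE muln0 muln0 expr0. Qed.

Lemma rho_munit j : rho q (munit j) = p ^+ j.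
Proof.
rewrite (rhoE q01) (bigD1 j)//= ffunE eqxx muln1 exprM big1 ?mulr1// => i /negPf ij.
by rewrite ffunE ij muln0 muln0 expr0.
Qed.

Lemma cross_munit x j : cross x (munit j) = mhead x j.
Proof.
rewrite cross_mhead (bigD1 j)//= big1 => [|i /negPf ij]; last by rewrite ffunE ij.
by rewrite ffunE eqxx mul1n addn0.
Qed.

Lemma zeta0 x : zeta q x 0 = hnorm2 q x.
Proof. by rewrite /zeta crossm0 expr0 expr1n mul1r addr0 hnorm2_0 divr1 rho0 mulr1. Qed.

Lemma zeta_munit x j : zeta q x (munit j) =
  hnorm2 q x * (p ^+ mhead x j * (1 - p ^+ (x j).+1) * p ^+ j) / (1 - p).
Proof.
have -> : 1 - p = hnorm2 q (munit j).
  by rewrite -[munit j]add0r hnorm2_munit hnorm2_0 mul1r ffunE expr1.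
rewrite /zeta cross_munit hnorm2_munit rho_munit -exprM mulnC exprM.
by field; rewrite gt_eqF// hnorm2_gt0.
Qed.

Lemma wnu_munit x j : wnu q (x + munit j) = wnu q x * (p ^+ j / p ^+ n.+1).
Proof.
rewrite /wnu rhoD// rho_munit mdegD mdeg_munit mulnDr muln1 exprD invfM -!exprM; ring.
Qed.

(** With F(J) = p^(x_0 + ... + x_(J-1) + J) the j-th term is F(j) - F(j + 1). *)
Lemma telescope_shifted x :
  \sum_(j < n.+1) p ^+ mhead x j * (1 - p ^+ (x j).+1) * p ^+ j = 1 - p ^+ (mdeg x + n.+1).
Proof.
pose f J := p ^+ (mhead x J + J).
rewrite (eq_bigr (fun j : 'I_n.+1 => f j - f j.+1)) => [|j _]; last first.
  by rewrite /f mheadS !exprD [p ^+ j.+1]exprS [p ^+ (x j).+1]exprS; ring.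
rewrite -(big_mkord xpredT (fun J => f J - f J.+1)).
rewrite -[LHS]opprK -sumrN (eq_bigr (fun J => f J.+1 - f J)) => [|J _]; last by rewrite opprB.
rewrite telescope_sumr// opprB /f mhead_max; congr (_ - _).
by rewrite addn0 /mhead big_pred0.
Qed.

Lemma telescope_plain x :
  \sum_(j < n.+1) p ^+ mhead x j * (1 - p ^+ x j) = 1 - p ^+ mdeg x.
Proof.
pose f J := p ^+ mhead x J.
rewrite (eq_bigr (fun j : 'I_n.+1 => f j - f j.+1)) => [|j _]; last first.
  by rewrite /f mheadS exprD; ring.
rewrite -(big_mkord xpredT (fun J => f J - f J.+1)).
rewrite -[LHS]opprK -sumrN (eq_bigr (fun J => f J.+1 - f J)) => [|J _]; last by rewrite opprB.
rewrite telescope_sumr// opprB /f mhead_max; congr (_ - _).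
by rewrite /mhead big_pred0.
Qed.

(** The three summands come from b = d = 0, from d = 0 and b a unit vector, and
    from b = 0 and d a unit vector, by [kernelX_coef1]. *)
Lemma symbolX_coef1 k x : (symbolX q k x)`_1 =
  (mdeg x == k)%:R * ((- p * (1 - p ^+ n.+1) - 2 * p ^+ n.+2 * (1 - p ^+ k)) / (1 - p)) +
  ((mdeg x).+1 == k)%:R * (p * (1 - p ^+ (mdeg x + n.+1)) / (1 - p)) +
  (mdeg x == k.+1)%:R * (p ^+ n.+2 * (1 - p ^+ mdeg x) / (1 - p)).
Proof.
pose g r e := (kernelX n q r e)`_1.
have g2 r e : (1 < e)%N -> g r e = 0 by rewrite /g kernelX_coef1//; case: e => [|[]].
pose H m d := \sum_(b <- box k.+2) (mdeg (m + b) == k)%:R *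
  (kappa q x m b d * g (mdeg m) (mdeg b + mdeg d)%N).
(* The boxes are enlarged so as to contain the unit vectors even if k or |x|
   is 0. *)
have -> : (symbolX q k x)`_1 =
    \sum_(d <- box (mdeg x).+2) \sum_(m <- box (mdeg x).+2) (x == m + d)%:R * H m d.
  rewrite exchange_big (sum_fibre (L := (mdeg x).+1)) ?mdeg_box// /symbolX.
  rewrite coef_sum; apply: eq_bigr => m _; rewrite coef_sum; apply: eq_bigr => d _.
  case: eqP => _; last by rewrite !mul0r coef0.
  rewrite !mul1r coef_sum /H (big_box_widen (leqnSn k.+1)) => [|b bK].
    by apply: eq_bigr => b _; case: eqP => _; rewrite ?mul0r ?coef0// !mul1r coefZ.
  case: eqP => [mb|]; last by rewrite mul0r.
  by case/negP: bK; apply: mdeg_box; rewrite ltnS -mb mdegD leq_addl.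
rewrite sum_mdeg_le1// => [|d d1]; last first.
  rewrite big1// => m _; rewrite /H big1 ?mulr0// => b _.
  by rewrite g2 ?mulr0// (leq_trans d1)// leq_addl.
have hx : hnorm2 q x != 0 by rewrite gt_eqF// hnorm2_gt0.
have wx : wnu q x != 0 by rewrite gt_eqF// wnu_gt0.
have xK : x \in box (mdeg x).+2 by exact: mdeg_box.
congr (_ + _).
  rewrite (big_box1 xK) => [|m /negPf mx]; last by rewrite addr0 eq_sym mx mul0r.
  rewrite addr0 eqxx mul1r /H sum_mdeg_le1// => [|b b1]; last first.
    by rewrite g2 ?mulr0// (leq_trans b1)// leq_addr.
  congr (_ + _).
    rewrite addr0; case: eqP => [xk|]; last by rewrite !mul0r.
    rewrite !mul1r !mdeg0 /g kernelX_coef1//= /kappa !zeta0 -xk.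
    by field; rewrite np1 hx wx.
  under eq_bigr => j _ do rewrite mdegD !mdeg_munit mdeg0 addn1 /g kernelX_coef1//=.
  rewrite -mulr_sumr; congr (_ * _); rewrite -telescope_shifted mulr_sumr mulr_suml.
  apply: eq_bigr => j _; rewrite /kappa zeta0 zeta_munit.
  by field; rewrite np1 hx wx.
rewrite -telescope_plain !mulr_sumr mulr_suml mulr_sumr; apply: eq_bigr => j _.
(* If x_j = 0 then x - e_j is not a multi-index, and the j-th term of the
   telescoping sum vanishes too. *)
have [xj|xj] := posnP (x j).
  rewrite xj expr0 subrr !(mulr0, mul0r) big1// => m _; case: eqP => [xm|]; last by rewrite mul0r.
  by move: xj; rewrite xm maddE ffunE eqxx addn1.
have xE : x = Defs.down j x + munit j.
  apply: mext => l; rewrite maddE !ffunE; case: eqP => [->|_]; last by rewrite subn0 addn0.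
  by rewrite subnK.
set m := Defs.down j x in xE.
have mK : m \in box (mdeg x).+2.
  by apply: mdeg_box; rewrite xE mdegD ltnS -addnS leq_addr.
rewrite (big_box1 mK) => [|m' m'm]; last first.
  rewrite {1}xE; case: eqP => [/maddIr mm|]; last by rewrite mul0r.
  by rewrite mm eqxx in m'm.
rewrite -xE eqxx mul1r /H.
have zK : (0 : mi n) \in box k.+2 by rewrite mdeg_box// mdeg0.
rewrite (big_box1 zK) => [|b b0]; last first.
  rewrite g2 ?mulr0// mdeg_munit addn1 ltnS lt0n; apply: contraNneq b0.
  by move=> /mdeg_eq0 ->.
rewrite addr0 mdeg0 mdeg_munit.
have dx : mdeg x = (mdeg m).+1 by rewrite {1}xE mdegD mdeg_munit addn1.
rewrite dx eqSS; case: eqP => _; last by rewrite !mul0r.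
rewrite !mul1r /g kernelX_coef1//= /kappa zeta0 zeta_munit.
have hm : hnorm2 q m != 0 by rewrite gt_eqF// hnorm2_gt0.
have wm : wnu q m != 0 by rewrite gt_eqF// wnu_gt0.
have -> : wnu q x = wnu q m * (p ^+ j / p ^+ n.+1) by rewrite {1}xE wnu_munit.
have -> : mhead x j = mhead m j.
  rewrite /mhead; apply: eq_bigr => i ij; rewrite ffunE -val_eqE/=.
  by rewrite (ltn_eqF ij) subn0.
have -> : x j = (m j).+1 by rewrite {1}xE maddE [munit j j]ffunE eqxx addn1.
have pj : p ^+ j != 0 by rewrite gt_eqF// exprn_gt0.
have pn : p ^+ n.+1 != 0 by rewrite gt_eqF// exprn_gt0.
rewrite [p ^+ n.+2]exprS; move: (p ^+ n.+1) pn => y yn.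
by field; rewrite np1 hm wm pj yn.
Qed.

End LinearCoefficient.

(** * The Laplace-Beltrami operator on radial functions *)

Section Laplacian.
Variables (R : realType) (n : nat) (q : R).
Hypothesis q01 : 0 < q < 1.
Local Notation C := R[i]^o.
Local Notation box := (box n).
Local Notation qop := (qop R n).
Local Notation p := (q ^+ 2).
Implicit Types (a b m d x : mi n) (f g S : qop) (P Q : {poly R[i]}).
Let q0 : 0 < q. Proof. by case/andP: q01. Qed.
Let q1 : q < 1. Proof. by case/andP: q01. Qed.

(** The values alpha = 1, 2, 3, ... give infinitely many points t. *)
Lemma poly_ext_powers P Q :
  (forall alpha : R, 0 < alpha -> P.[(q `^ (2 * alpha))%:C] = Q.[(q `^ (2 * alpha))%:C]) ->
  P = Q.
Proof.
move=> PQ; apply/eqP; rewrite -subr_eq0; apply/negPn/negP => nz.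
pose rs := [seq (q ^+ (2 * i.+1))%:C | i <- iota 0 (size (P - Q))].
have : (size rs < size (P - Q)%R)%N.
  apply: (max_poly_roots nz).
    apply/allP => _ /mapP[i _ ->]; rewrite rootE !hornerE.
    have := PQ i.+1%:R (ltr0Sn _ _).
    by rewrite -natrM powR_mulrn ?ltW// => ->; rewrite subrr.
  rewrite map_inj_uniq ?iota_uniq// => i j [] /(ieexprIn q0 _) => h.
  have /h : q != 1 by rewrite lt_eqF.
  by move=> /eqP; rewrite eqn_pmul2l// eqSS => /eqP.
by rewrite size_map size_iota ltnn.
Qed.

(** Only the coefficient of t of the polynomial [symbolX] matters, since the
    pairing with g is linear in the entries of the symbol. *)
Lemma laplace_level k : laplace q (diag_op (@level R n k)) =
  diag_op (fun x => (q ^- (2 * n.+1) / (1 - p) * (symbolX q k x)`_1)%:C) :> qop.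
Proof.
set L := RHS.
have key g : finite_op g -> exists2 P : {poly R[i]},
   (forall alpha : R, 0 < alpha ->
     P.[(q `^ (2 * alpha))%:C] = int_nu q (qmul (berezin q alpha (diag_op (@level R n k))) g))
   & int_nu q (qmul L g) = (q ^- (2 * n.+1) / (1 - q ^+ 2))%:C * P^`().[0].
  move=> /finite_opP[K gK].
  exists ((qpoch p p n.+1)%:C *: \sum_(x <- box K)
    (g x x * (wnu q x)%:C) *: map_poly (real_complex R) (symbolX q k x)).
    move=> alpha alpha0; rewrite (berezinE q01 alpha0 (@level_boxed R n k)).
    rewrite (int_nu_mul_diag q01 _ gK) hornerZ horner_sum; congr (_ * _).
    apply: eq_bigr => x _; rewrite hornerZ horner_map symbolX_eval//.
    by rewrite mulrC mulrA.
  rewrite (int_nu_mul_diag q01 _ gK) horner_coef0 coef_deriv mulr1n coefZ coef_sum.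
  rewrite mulrCA; congr (_ * _); rewrite mulr_sumr; apply: eq_bigr => x _.
  rewrite coefZ coef_map [X in X * _ * _ = _]rmorphM /=.
  by move: (_ / _)%:C (_`_1)%:C (g x x) (wnu q x)%:C => u v w t; clear - u; ring.
apply: xget_unique => [|L' hL'] //; apply: (int_nu_inj q01) => g fg.
have [P hP ->] := hL' g fg; have [Q hQ ->] := key g fg.
by rewrite (@poly_ext_powers P Q) // => alpha alpha0; rewrite hP// hQ.
Qed.

Lemma radial_level (k : nat) : radial n q k%:Z = diag_op (@level R n k).
Proof.
apply/funext => a; apply/funext => b; rewrite /radial /fun_y /diag_op /level /Defs.point.
congr (_ * (nat_of_bool _)%:R); rewrite tailsE tail0; apply/eqP/eqP => [|->//].
have q1' : q != 1 by rewrite lt_eqF.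
by move/(ieexprIn q0 q1')/eqP; rewrite eqn_pmul2l// => /eqP.
Qed.

Lemma radial_pred (k : nat) : radial n q (k%:Z - 1) = diag_op (fun b => ((mdeg b).+1 == k)%:R).
Proof.
case: k => [|k].
  by apply/funext => a; apply/funext => b; rewrite /diag_op mulr0.
have -> : k.+1%:Z - 1 = k%:Z by rewrite -[k.+1]addn1 PoszD addrK.
by rewrite radial_level.
Qed.

End Laplacian.

Theorem proposition4p3 (R : realType) (n : nat) (q : R) (k : nat) :
  0 < q < 1 ->
  laplace q (radial n q k%:Z) =
  (q ^+ 2 / (1 - q ^+ 2) ^+ 2)%:C *:
    ((1 - q ^+ (2 * k + 2))%:C *: radial n q (k%:Z + 1)
     - (1 + q ^- (2 * n.+1) - 2 * q ^+ (2 * k))%:C *: radial n q k%:Z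
     + (q ^- (2 * n.+1) - q ^ (2 * k%:Z - 2))%:C *: radial n q (k%:Z - 1)).
Proof.
move=> q01; have /andP[q0 q1] := q01; have /andP[p0 p1] := qsq q01.
have -> : k%:Z + 1 = k.+1%:Z by rewrite -addn1 PoszD.
rewrite radial_pred// !radial_level// laplace_level//.
apply/funext => a; apply/funext => b.
rewrite !qopZ !(qopD, qopN, qopZ) /diag_op /level.
have [ab|ab] := eqVneq a b; last by rewrite !mul0r !mulr0 subrr addr0 mulr0.
rewrite !mul1r symbolX_coef1// -!(rmorph_nat (real_complex R)).
rewrite -!rmorphM -!(rmorphB, rmorphD) -!rmorphM.
congr (_%:C).
have np1 : 1 - q ^+ 2 != 0 by rewrite subr_eq0 gt_eqF.
have yn : (q ^+ 2) ^+ n.+1 != 0 by rewrite gt_eqF// exprn_gt0.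
have -> : q ^+ (2 * k + 2) = q ^+ 2 * (q ^+ 2) ^+ k by rewrite -exprM -exprD addnC.
rewrite !(exprM q 2) exprD [(q ^+ 2) ^+ n.+2]exprS.
move: ((q ^+ 2) ^+ n.+1) yn => y yn; set D := mdeg b.
have [Dk|Dk] := eqVneq D k.
  have -> : (D.+1 == k) = false by lia.
  have -> : (D == k.+1) = false by lia.
  by rewrite !(mul0r, mulr0) -Dk; field; rewrite np1 yn.
have [Dk'|Dk'] := eqVneq D.+1 k.
  have -> : (D == k.+1) = false by lia.
  rewrite -Dk' !(mul0r, mulr0) (_ : q ^ (2 * D.+1%:Z - 2) = (q ^+ 2) ^+ D).
    by field; rewrite np1 yn.
  rewrite -exprM (_ : 2 * D.+1%:Z - 2 = (2 * D)%N%:Z)//; lia.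
have [->|Dk''] := eqVneq D k.+1; last by rewrite !(mul0r, mulr0) subrr !addr0 !mulr0.
rewrite !(mul0r, mulr0) [(q ^+ 2) ^+ k.+1]exprS.
by field; rewrite np1 yn.
Qed.
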